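(* Let $Z$ be a $JC^*$-triple system spanned by a symplectic grid $\{u_{ij}:1\le i,j\le n,\ i\neq j\}$ with $\dim Z\geq 10$. Then $T^*(Z)$ is TRO-isomorphic to $\mathbb{M}_n$.
   Context: $\mathbb{M}_n$ denotes the complex $n\times n$-matrices. A $JC^*$-triple system is a closed subspace of a $C^*$-algebra invariant under $\{a,b,c\}=\frac12(ab^*c+cb^*a)$; a $JB^*$-triple homomorphism is a linear map preserving the triple product. A tripotent is an element $e$ with $\{e,e,e\}=e$; it is minimal (in $Z$) if $\{e,Z,e\}=\mathbb{C}e$. A symplectic grid is a family $\{u_{ij}:i,j\in I,\ i\ne j\}$ of non-zero minimal tripotents such that for all $i,j,k,l\in I$: (SYG1) $u_{ij}=-u_{ji}$ for $i\neq j$. (SYG2) $\{u_{ij},u_{ij},u_{kl}\}=\frac12u_{kl}$ and $\{u_{kl},u_{kl},u_{ij}\}=\frac12u_{ij}$ if $\{i,j\}\cap\{k,l\}\ne\emptyset$ and $\{i,j\}\neq\{k,l\}$. (SYG3) $\{u_{kl},u_{kl},u_{ij}\}=0$ if $\{i,j\}\cap\{k,l\}=\emptyset$. (SYG4) $\{u_{ij},u_{il},u_{kl}\}=\frac12u_{kj}$ for $i,j,k,l$ pairwise distinct. (SYG5) All other triple products in the grid (apart from those forced by (SYG1) and $\{u_{ij},u_{ij},u_{ij}\}=u_{ij}$) are $0$. A TRO is a closed subspace $T\subseteq B(H)$, $H$ a Hilbert space, with $xy^*z\in T$ for all $x,y,z\in T$; it carries the triple product $\frac12(xy^*z+zy^*x)$.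 TRO-homomorphisms are linear maps preserving $xy^*z$. The universal enveloping TRO of $Z$ is the TRO $T^*(Z)$, unique up to TRO-isomorphism, with a $JB^*$-triple homomorphism $\rho_Z:Z\to T^*(Z)$ such that $\rho_Z(Z)$ generates $T^*(Z)$ as a TRO and every $JB^*$-triple homomorphism $\alpha:Z\to T$ into a TRO $T$ factors as $\alpha=T^*(\alpha)\circ\rho_Z$ with $T^*(\alpha):T^*(Z)\to T$ a TRO-homomorphism. *)

(* Defs.v *)
From HB Require Import structures.
From mathcomp Require Import all_boot all_order all_algebra.
From mathcomp Require Import complex.
From mathcomp Require Import boolp classical_sets functions reals topology.
From mathcomp Require Import normedtype.

Set Implicit Arguments.
Unset Strict Implicit.
Unset Printing Implicit Defensive.

Import Order.TTheory GRing.Theory Num.Theory.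
Import numFieldNormedType.Exports.

Local Open Scope classical_set_scope.
Local Open Scope ring_scope.
Local Open Scope complex_scope.

(* Not necessarily unital, hence not built on the MathComp ring hierarchy,
   whose rings all have a 1. *)
Record cstarAlgType (R : realType) := CstarAlg {
  cstar_sort :> completeNormedModType R[i];
  cmul : cstar_sort -> cstar_sort -> cstar_sort;
  cstar : cstar_sort -> cstar_sort;
  cmulA : forall x y z, cmul x (cmul y z) = cmul (cmul x y) z;
  cmul_linearl : forall a x y z,
    cmul (a *: x + y) z = a *: cmul x z + cmul y z;
  cmul_linearr : forall a x y z,
    cmul z (a *: x + y) = a *: cmul z x + cmul z y;
  cstarK : forall x, cstar (cstar x) = x;
  cstar_antilinear : forall a x y,
    cstar (a *: x + y) = Num.conj a *: cstar x + cstar y;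
  cstarM : forall x y, cstar (cmul x y) = cmul (cstar y) (cstar x);
  cnormM : forall x y, `|cmul x y| <= `|x| * `|y|;
  cnorm_cstar : forall x, `|cmul (cstar x) x| = `|x| ^+ 2 }.

Record hilbertType (R : realType) := Hilbert {
  hilbert_sort :> completeNormedModType R[i];
  hdot : {dot hilbert_sort for Num.conj};
  hdot_norm : forall x, `|x| ^+ 2 = hdot x x }.

Section LinearAlgebra.
Context {K : numFieldType}.
Implicit Types (V W : lmodType K).

Definition is_subspace V (Z : set V) : Prop :=
  Z 0 /\ forall (a : K) (x y : V), Z x -> Z y -> Z (a *: x + y).

Definition linearly_independent V (m : nat) (v : 'I_m -> V) : Prop :=
  forall c : 'I_m -> K, \sum_(i < m) c i *: v i = 0 -> forall i, c i = 0.

(* dim Z >= m, for a possibly infinite-dimensional subspace Z *)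
Definition dim_ge V (Z : set V) (m : nat) : Prop :=
  exists2 v : 'I_m -> V, (forall i, Z (v i)) & linearly_independent v.

Definition linear_on V W (D : set V) (f : V -> W) : Prop :=
  forall (a : K) (x y : V), D x -> D y -> f (a *: x + y) = a *: f x + f y.

(* f restricts to a linear map from Z to Z' that carries the ternary product
   t to the ternary product t'; the values of f outside Z are irrelevant. *)
Definition ternary_hom V W (Z : set V) (t : V -> V -> V -> V)
    (Z' : set W) (t' : W -> W -> W -> W) (f : V -> W) : Prop :=
  [/\ set_fun Z Z' f, linear_on Z f &
      forall x y z, Z x -> Z y -> Z z -> f (t x y z) = t' (f x) (f y) (f z)].

(* {x,y,z} = 1/2 (xy*z + zy*x), where t x y z stands for xy*z *)
Definition jordan_triple V (t : V -> V -> V -> V) (x y z : V) : V :=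
  2^-1 *: (t x y z + t z y x).

End LinearAlgebra.

Section JCstarTriple.
Context {R : realType} {A : cstarAlgType R}.
Implicit Types (Z : set A).

Definition cstar_ternary (x y z : A) : A := cmul (cmul x (cstar y)) z.

Definition cstar_triple : A -> A -> A -> A := jordan_triple cstar_ternary.

Local Notation "'{|' x , y , z '|}'" := (cstar_triple x y z).

Definition is_JCstar_triple Z : Prop :=
  [/\ is_subspace Z, closed Z &
      forall x y z, Z x -> Z y -> Z z -> Z {|x, y, z|}].

Definition tripotent (e : A) : Prop := {|e, e, e|} = e.

Definition minimal_tripotent Z (e : A) : Prop :=
  [/\ Z e, tripotent e &
      [set {|e, z, e|} | z in Z] = [set a *: e | a in [set: R[i]]]].

(* The triple products of grid elements u_p, u_q, u_r (p, q, r two-element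
   index sets) on which (SYG2)-(SYG4) and tripotency say something. Working
   with unordered index pairs accounts for (SYG1), and the symmetry
   {x,y,z} = {z,y,x} is built in: if p = q or r = q, the product is
   {u_p,u_p,u_r} or {u_r,u_r,u_p}, which is the subject of (SYG2), of (SYG3)
   or of tripotency; the last disjunct is (SYG4), whose shape is invariant
   under exchanging p and r. *)
Definition grid_product_prescribed (I : finType) (p q r : {set I}) : Prop :=
  [\/ p = q, r = q |
      exists i j k l : I, uniq [:: i; j; k; l] /\
        [/\ p = [set i; j]%SET, q = [set i; l]%SET & r = [set k; l]%SET]].

(* Only the values u i j with i != j are meaningful. *)
Record symplectic_grid (I : finType) Z (u : I -> I -> A) : Prop := {
  syg_neq0 : forall i j, i != j -> u i j != 0;
  syg_minimal : forall i j, i != j -> minimal_tripotent Z (u i j);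
  syg1 : forall i j, i != j -> u i j = - u j i;
  syg2 : forall i j k l, i != j -> k != l ->
    ([set i; j] :&: [set k; l] != finset.set0)%SET ->
    ([set i; j] != [set k; l])%SET ->
    {|u i j, u i j, u k l|} = 2^-1 *: u k l /\
    {|u k l, u k l, u i j|} = 2^-1 *: u i j;
  syg3 : forall i j k l, i != j -> k != l ->
    ([set i; j] :&: [set k; l] = finset.set0)%SET ->
    {|u k l, u k l, u i j|} = 0;
  syg4 : forall i j k l, uniq [:: i; j; k; l] ->
    {|u i j, u i l, u k l|} = 2^-1 *: u k j;
  syg5 : forall i j k l p q, i != j -> k != l -> p != q ->
    ~ grid_product_prescribed [set i; j]%SET [set k; l]%SET [set p; q]%SET ->
    {|u i j, u k l, u p q|} = 0 }.

Definition grid_span (I : finType) (u : I -> I -> A) : set A :=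
  [set x | exists c : I -> I -> R[i],
             x = \sum_i \sum_(j | j != i) c i j *: u i j].

End JCstarTriple.

Section TRO.
Context {R : realType} {H : hilbertType R}.
Implicit Types (f g : H -> H) (T : set (H -> H)).

(* B(H), inside the vector space of all maps H -> H *)
Definition bounded_operator f : Prop :=
  linear f /\ exists M : R[i], forall x, `|f x| <= M * `|x|.

(* For f in B(H), the vector z below exists by the Riesz representation
   theorem and is unique. *)
Definition adjoint f : H -> H :=
  fun y => xget 0 [set z | forall x, hdot H (f x) y = hdot H x z].

Definition op_ternary f g h : H -> H := f \o adjoint g \o h.

Definition op_triple : (H -> H) -> (H -> H) -> (H -> H) -> (H -> H) :=
  jordan_triple op_ternary.

(* T contains every f in B(H) that is a limit of elements of T for the
   operator norm *)
Definition op_norm_closed T : Prop :=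
  forall f, bounded_operator f ->
    (forall e : R[i], 0 < e ->
       exists2 g, T g & forall x, `|f x - g x| <= e * `|x|) ->
    T f.

Definition is_TRO T : Prop :=
  [/\ T `<=` bounded_operator, is_subspace T, op_norm_closed T &
      forall f g h, T f -> T g -> T h -> T (op_ternary f g h)].

End TRO.

Section UniversalTRO.
Context {R : realType} {A : cstarAlgType R}.

Definition JB_hom (Z : set A) (H : hilbertType R) (T : set (H -> H))
    (rho : A -> H -> H) : Prop :=
  ternary_hom Z cstar_triple T op_triple rho.

Definition TRO_hom (H H' : hilbertType R)
    (T : set (H -> H)) (T' : set (H' -> H')) (phi : (H -> H) -> H' -> H') :
    Prop :=
  ternary_hom T op_ternary T' op_ternary phi.

(* (T, rho) is a model of (T*(Z), rho_Z) *)
Definition is_universal_TRO (Z : set A) (H : hilbertType R)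
    (T : set (H -> H)) (rho : A -> H -> H) : Prop :=
  [/\ is_TRO T, JB_hom Z T rho, smallest is_TRO (rho @` Z) = T &
      forall (H' : hilbertType R) (T' : set (H' -> H')) (alpha : A -> H' -> H'),
        is_TRO T' -> JB_hom Z T' alpha ->
        exists2 phi : (H -> H) -> H' -> H', TRO_hom T T' phi &
          forall z, Z z -> alpha z = phi (rho z)].

End UniversalTRO.

Definition mx_ternary (R : realType) (n : nat) (x y z : 'M[R[i]]_n) :
  'M[R[i]]_n := x *m map_mx Num.conj y^T *m z.

Definition TRO_isomorphic_mx (R : realType) (H : hilbertType R)
    (T : set (H -> H)) (n : nat) : Prop :=
  exists phi : (H -> H) -> 'M[R[i]]_n,
    ternary_hom T op_ternary [set: 'M[R[i]]_n] (@mx_ternary R n) phi /\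
    set_bij T [set: 'M[R[i]]_n] phi.

(* Main.v *)
(* Put n >= 5 and let v_ij be the images of the grid in a *-algebra. The products
   v_kl v_il^* do not depend on l and multiply like the matrix units E_ki; applied
   to the v_ij they yield elements e_kj = v_kl v_il^* v_ij that satisfy
   e_ij e_kl^* e_pq = [j = l][k = p] e_iq and v_ij = e_ij - e_ji. So every Jordan
   homomorphism on Z extends to the ternary matrix units. Applied inside the
   C*-algebra containing Z, this identifies Z with the skew-symmetric matrices;
   applied to a homomorphism into a TRO (where adjoints exist by the Riesz
   representation theorem), it gives the factorization through M_n = B(l^2_n).
   Finally a linear span of ternary matrix units in B(H) is norm closed, so the
   TRO generated by the image of Z is exactly the span of the e_ij. *)
Require Import Defs.
From HB Require Import structures.
From mathcomp Require Import all_boot all_order all_algebra.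
From mathcomp Require Import complex spectral.
From mathcomp Require Import boolp classical_sets functions reals topology normedtype.
From mathcomp Require Import lra ring.

Set Implicit Arguments.
Unset Strict Implicit.
Unset Printing Implicit Defensive.

Import Order.TTheory GRing.Theory Num.Theory.
Import numFieldNormedType.Exports.

Local Open Scope classical_set_scope.
Local Open Scope ring_scope.

(** * Algebras with involution *)

(** A common home for the C*-algebra around [Z] and for operators with an adjoint: the matrix units
    are built once, purely algebraically. *)
Record starAlgType (K : numClosedFieldType) := StarAlg {
  star_sort :> lmodType K;
  smul : star_sort -> star_sort -> star_sort;
  sstar : star_sort -> star_sort;
  smulA : associative smul;
  smul_linearl : forall a x y z,
    smul (a *: x + y) z = a *: smul x z + smul y z;
  smul_linearr : forall a x y z,
    smul z (a *: x + y) = a *: smul z x + smul z y;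
  sstarK : involutive sstar;
  sstar_antilinear : forall a x y,
    sstar (a *: x + y) = Num.conj a *: sstar x + sstar y;
  sstarM : forall x y, sstar (smul x y) = smul (sstar y) (sstar x) }.

Declare Scope star_scope.
Delimit Scope star_scope with star.
Notation "x ** y" := (smul x y) (at level 40, left associativity) : star_scope.
Notation "x ^'" := (sstar x) : star_scope.
Local Open Scope star_scope.

Section StarAlgTheory.
Context {K : numClosedFieldType} {V : starAlgType K}.
Implicit Types x y z : V.

Definition sternary x y z : V := x ** y^' ** z.

Lemma smulDl x y z : (x + y) ** z = x ** z + y ** z.
Proof. by rewrite -[x in LHS]scale1r smul_linearl scale1r. Qed.

Lemma smulDr x y z : z ** (x + y) = z ** x + z ** y.
Proof. by rewrite -[x in LHS]scale1r smul_linearr scale1r. Qed.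

Lemma sstarD x y : (x + y)^' = x^' + y^'.
Proof. by rewrite -[x in LHS]scale1r sstar_antilinear rmorph1 scale1r. Qed.

Lemma smul0l z : 0 ** z = 0.
Proof. by apply: (addrI (0 ** z)); rewrite -smulDl !addr0. Qed.

Lemma smul0r z : z ** 0 = 0.
Proof. by apply: (addrI (z ** 0)); rewrite -smulDr !addr0. Qed.

Lemma sstar0 : 0^' = 0 :> V.
Proof. by apply: (addrI (0^')); rewrite -sstarD !addr0. Qed.

Lemma smulZl a x z : (a *: x) ** z = a *: (x ** z).
Proof. by rewrite -[a *: x]addr0 smul_linearl smul0l addr0. Qed.

Lemma smulZr a x z : z ** (a *: x) = a *: (z ** x).
Proof. by rewrite -[a *: x]addr0 smul_linearr smul0r addr0. Qed.

Lemma sstarZ a x : (a *: x)^' = Num.conj a *: x^'.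
Proof. by rewrite -[a *: x]addr0 sstar_antilinear sstar0 addr0. Qed.

Lemma smulNl x z : (- x) ** z = - (x ** z).
Proof. by rewrite -[- x in LHS]scaleN1r smulZl scaleN1r. Qed.

Lemma smulNr x z : z ** (- x) = - (z ** x).
Proof. by rewrite -[- x in LHS]scaleN1r smulZr scaleN1r. Qed.

Lemma sstarN x : (- x)^' = - x^'.
Proof. by rewrite -[- x in LHS]scaleN1r sstarZ rmorphN1 scaleN1r. Qed.

Lemma smul_suml (I : finType) (F : I -> V) z :
  (\sum_i F i) ** z = \sum_i F i ** z.
Proof.
by apply: (big_morph (fun x => x ** z)) => [x y|]; rewrite ?smulDl ?smul0l.
Qed.

Lemma smul_sumr (I : finType) (F : I -> V) z :
  z ** (\sum_i F i) = \sum_i z ** F i.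
Proof.
by apply: (big_morph (fun x => z ** x)) => [x y|]; rewrite ?smulDr ?smul0r.
Qed.

Lemma sstar_sum (I : finType) (F : I -> V) : (\sum_i F i)^' = \sum_i (F i)^'.
Proof. by apply: big_morph => [x y|]; rewrite ?sstarD ?sstar0. Qed.

(* The Jordan triple orthogonality of a partial isometry u to w already forces
   the associative one: with c = uu*wu*u, multiplying uu*w + wu*u = 0 by uu* on
   the left and by u*u on the right gives uu*w = -c = wu*u, whence 2c = 0. *)
Lemma jordan_orthogonal (u w : V) : u ** u^' ** u = u ->
  u ** u^' ** w + w ** u^' ** u = 0 -> u^' ** w = 0 /\ w ** u^' = 0.
Proof.
move=> uK; set a := _ ** w; set b := _ ** u => ab0.
have uKr (x : V) : x ** u ** u^' ** u = x ** u by rewrite -!smulA (smulA u) uK.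
have uK' : u^' ** u ** u^' = u^'.
  by rewrite -[RHS](congr1 (@sstar K V) uK) !sstarM sstarK smulA.
have uKr' (x : V) : x ** u^' ** u ** u^' = x ** u^'.
  by rewrite -!smulA (smulA (u^')) uK'.
pose c := u ** u^' ** w ** u^' ** u.
have acE : a + c = 0.
  have := congr1 (fun x => u ** u^' ** x) ab0.
  by rewrite smulDr smul0r /a /b !smulA uK.
have bcE : c + b = 0.
  have := congr1 (fun x => x ** u^' ** u) ab0.
  by rewrite !smulDl !smul0l /a /b uKr'.
have c0 : c = 0.
  have: a + b + (c + c) = 0 by rewrite addrACA acE [b + c]addrC bcE addr0.
  rewrite ab0 add0r -mulr2n -scaler_nat => /eqP.
  by rewrite scaler_eq0 pnatr_eq0 /= => /eqP.
move: acE bcE; rewrite c0 addr0 add0r => a0 b0; split.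
  by rewrite -uK' -!smulA (smulA u) -/a a0 smul0r.
by rewrite -uKr' -/b b0 smul0l.
Qed.

End StarAlgTheory.

(** * Matrix units from a symplectic grid *)

(** The grid relations with the factor 1/2 cleared, in associative products; in this form triple
    homomorphisms transport them to the images of the grid. *)
Record symplectic_laws (K : numClosedFieldType) (V : starAlgType K)
    (I : eqType) (v : I -> I -> V) : Prop := {
  symp_opp : forall i j, i != j -> v j i = - v i j;
  symp_tripotent : forall i j, i != j -> sternary (v i j) (v i j) (v i j) = v i j;
  symp_collinear : forall i j k, uniq [:: i; j; k] ->
    sternary (v i j) (v i j) (v i k) + sternary (v i k) (v i j) (v i j) = v i k;
  symp_orthogonal : forall i j k l, uniq [:: i; j; k; l] ->
    sternary (v i j) (v i j) (v k l) + sternary (v k l) (v i j) (v i j) = 0;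
  symp_quadrangle : forall i j k l, uniq [:: i; j; k; l] ->
    sternary (v i j) (v i l) (v k l) + sternary (v k l) (v i l) (v i j) = v k j }.

(** Only ternary products are prescribed, since a TRO need not be closed under binary ones. *)
Definition matrix_units (K : numClosedFieldType) (V : starAlgType K)
    (I : eqType) (e : I -> I -> V) : Prop :=
  forall i j k l p q, sternary (e i j) (e k l) (e p q) =
    if (j == l) && (k == p) then e i q else 0.

Ltac distinct :=
  repeat match goal with
  | H : is_true (_ \notin _) |- _ => rewrite !inE ?negb_or in H
  | H : is_true (uniq _) |- _ => rewrite /= !inE ?negb_or ?andbT in H
  | H : is_true (_ && _) |- _ =>
      let H1 := fresh "neq" in let H2 := fresh "neq" in case/andP: H => H1 H2
  end;
  rewrite /= ?inE ?negb_or ?andbT;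
  repeat (apply/andP; split);
  first [assumption | by rewrite eq_sym].

Section SymplecticGrid.
Context {K : numClosedFieldType} {V : starAlgType K} {I : finType}.
Context (I5 : (4 < #|I|)%N) (v : I -> I -> V) (vG : symplectic_laws v).

(** This is where n >= 5 enters: the constructions below keep asking for an index away from at most
    four others. *)
Lemma fresh_index (s : seq I) : (size s < 5)%N -> exists m, m \notin s.
Proof.
move=> s5; apply/existsP; rewrite -negb_forall; apply/negP => /forallP sI.
have Is : (#|I| <= #|s|)%N by apply/subset_leq_card/fintype.subsetP => x _.
by have := leq_trans (leq_ltn_trans (leq_trans Is (card_size s)) s5) I5; rewrite ltnn.
Qed.

Lemma symp_orthogonal_l i j k l : uniq [:: i; j; k; l] -> (v i j)^' ** v k l = 0.
Proof.
move=> u; have ij : i != j by distinct.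
by have [] := jordan_orthogonal (symp_tripotent vG ij) (symp_orthogonal vG u).
Qed.

Lemma symp_orthogonal_r i j k l : uniq [:: i; j; k; l] -> v i j ** (v k l)^' = 0.
Proof.
move=> u; have kl : k != l by distinct.
have u' : uniq [:: k; l; i; j] by distinct.
by have [] := jordan_orthogonal (symp_tripotent vG kl) (symp_orthogonal vG u').
Qed.

(** A fifth index m expands v_ik as v_mk v_mj^* v_ij + v_ij v_mj^* v_mk. In the adjoint of either
    summand v_mk^* stands at an outer end, where it meets the orthogonal element v_il or v_ij. *)
Lemma symp_star0 i j k l : uniq [:: i; j; k; l] ->
  v i j ** (v i k)^' ** v i l = 0.
Proof.
move=> u; have [m mP] := @fresh_index [:: i; j; k; l] isT.
have u' : uniq [:: m; k; i; j] by distinct.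
rewrite -(symp_quadrangle vG u') sstarD !sstarM !sstarK smulDr smulDl !smulA.
rewrite [v i j ** (v m k)^']symp_orthogonal_r; last by distinct.
by rewrite !smul0l addr0 -smulA symp_orthogonal_l ?smul0r//; distinct.
Qed.

Lemma symp_star0_r i j k l : uniq [:: i; j; k; l] ->
  v j i ** (v k i)^' ** v l i = 0.
Proof.
move=> u; rewrite ![v _ i](symp_opp vG); do ?by distinct.
by rewrite sstarN !(smulNl, smulNr) symp_star0 ?oppr0//; distinct.
Qed.

Lemma symp_collinear_r i j k : uniq [:: i; j; k] ->
  sternary (v j i) (v j i) (v k i) + sternary (v k i) (v j i) (v j i) = v k i.
Proof.
move=> u; rewrite ![v _ i](symp_opp vG); do ?by distinct.
rewrite /sternary sstarN !(smulNl, smulNr) !opprK -opprD.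
by congr -%R; exact: symp_collinear.
Qed.

(* v_kl v_il^* plays the part of the matrix unit E_ki of the left algebra. *)
Lemma symp_left_unit_indep k i l m : uniq [:: k; i; l; m] ->
  v k l ** (v i l)^' = v k m ** (v i m)^'.
Proof.
move=> u; have u1 : uniq [:: i; l; k; m] by distinct.
have u2 : uniq [:: i; l; m] by distinct.
(* Both sides equal v_km v_im^* v_il v_il^*: the right one by collinearity of v_il and v_im, the
   left one by the quadrangle expansion of v_kl. *)
have := congr1 (fun x => v k m ** x^') (symp_collinear vG u2).
rewrite /sternary sstarD !sstarM !sstarK smulDr !smulA.
rewrite [v k m ** (v i l)^']symp_orthogonal_r; last by distinct.
rewrite !smul0l addr0.
move=> <-; rewrite -{1}(symp_quadrangle vG u1) /sternary smulDl.
rewrite -[X in X + _]smulA [v k m ** (v i l)^']symp_orthogonal_r; last by distinct.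
by rewrite smul0r add0r.
Qed.

(** The default [k] is never returned for lists of at most four indices. *)
Definition fresh_elt (s : seq I) (k : I) : I := odflt k [pick m | m \notin s].

Lemma fresh_notin s k : (size s < 5)%N -> fresh_elt s k \notin s.
Proof.
move=> /fresh_index[m ms]; rewrite /fresh_elt.
by case: pickP => [//|/(_ m)]; rewrite ms.
Qed.

Definition offdiag_unit k i : V :=
  let l := fresh_elt [:: k; i] k in v k l ** (v i l)^'.

Lemma offdiag_unitE k i l : uniq [:: k; i; l] ->
  offdiag_unit k i = v k l ** (v i l)^'.
Proof.
move=> u; rewrite /offdiag_unit; set m := fresh_elt _ _.
have mP : m \notin [:: k; i] by exact: fresh_notin.
have [->//|lm] := eqVneq l m.
by apply: symp_left_unit_indep; distinct.
Qed.

Lemma offdiag_unit_star k i : k != i -> (offdiag_unit k i)^' = offdiag_unit i k.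
Proof.
move=> ki; have [l lP] := @fresh_index [:: k; i] isT.
rewrite (@offdiag_unitE k i l); last by distinct.
by rewrite (@offdiag_unitE i k l) ?sstarM ?sstarK//; distinct.
Qed.

(** Collinearity of v_il and v_jl splits v_jl^* in two; multiplied by v_kl, one part vanishes by
    [symp_star0_r] and the other is the product sought. *)
Lemma offdiag_unitM k i j : uniq [:: k; i; j] ->
  offdiag_unit k i ** offdiag_unit i j = offdiag_unit k j.
Proof.
move=> u; have [l lP] := @fresh_index [:: k; i; j] isT.
rewrite (@offdiag_unitE k i l); last by distinct.
rewrite (@offdiag_unitE i j l); last by distinct.
rewrite (@offdiag_unitE k j l); last by distinct.
have u' : uniq [:: l; i; j] by distinct.
have := congr1 (fun x => v k l ** x^') (symp_collinear_r u').
rewrite /sternary sstarD !sstarM !sstarK smulDr !smulA.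
by rewrite symp_star0_r ?smul0l ?add0r//; distinct.
Qed.

(** Different auxiliary indices l and m for the two factors make the inner product v_il^* v_jm
    vanish by orthogonality. *)
Lemma offdiag_unit_mul0 a i j b : a != i -> j != b -> i != j ->
  offdiag_unit a i ** offdiag_unit j b = 0.
Proof.
move=> ai jb ij; have [l lP] := @fresh_index [:: a; i; j] isT.
have [m mP] := @fresh_index [:: j; b; i; l] isT.
rewrite (@offdiag_unitE a i l); last by distinct.
rewrite (@offdiag_unitE j b m); last by distinct.
rewrite smulA -[v a l ** _ ** _]smulA symp_orthogonal_l ?smul0r ?smul0l//.
by distinct.
Qed.

Lemma offdiag_unit_mulv0 a r i j : uniq [:: r; i; j] -> a != r ->
  offdiag_unit a r ** v i j = 0.
Proof.
move=> u ar; have [m mP] := @fresh_index [:: a; r; i; j] isT.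
rewrite (@offdiag_unitE a r m); last by distinct.
by rewrite -smulA symp_orthogonal_l ?smul0r//; distinct.
Qed.

(** For skew-symmetric matrices v_kl v_kl^* is E_kk + E_ll, so the diagonal units are obtained
    instead as E_ka E_ak. *)
Definition left_unit k i : V :=
  let a := fresh_elt [:: k; i] k in offdiag_unit k a ** offdiag_unit a i.

Lemma left_unit_offdiag k i : k != i -> left_unit k i = offdiag_unit k i.
Proof.
move=> ki; rewrite /left_unit; set m := fresh_elt _ _.
have mP : m \notin [:: k; i] by exact: fresh_notin.
by rewrite offdiag_unitM//; distinct.
Qed.

(** On the diagonal, E_kb E_bk = E_kb E_ba E_ak = E_ka E_ak. *)
Lemma left_unitE k i a : a \notin [:: k; i] ->
  left_unit k i = offdiag_unit k a ** offdiag_unit a i.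
Proof.
move=> aP; have [ki|ki] := eqVneq k i; last first.
  by rewrite left_unit_offdiag// offdiag_unitM//; distinct.
move: aP; rewrite -{}ki /left_unit => aP; set b := fresh_elt _ _.
have bP : b \notin [:: k; k] by exact: fresh_notin.
have [->//|ab] := eqVneq a b.
have u1 : uniq [:: b; a; k] by distinct.
have u2 : uniq [:: k; b; a] by distinct.
by rewrite -(offdiag_unitM u1) smulA offdiag_unitM.
Qed.

Lemma left_unit_star k i : (left_unit k i)^' = left_unit i k.
Proof.
have [a aP] := @fresh_index [:: k; i] isT.
rewrite (left_unitE aP) (@left_unitE i k a); last by distinct.
by rewrite sstarM !offdiag_unit_star//; distinct.
Qed.

(** Routing the factors through distinct fresh a and b leaves E_ai E_jb in the middle, which is E_ab
    or 0. *)
Lemma left_unitM k i j m :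
  left_unit k i ** left_unit j m = if i == j then left_unit k m else 0.
Proof.
have [a aP] := @fresh_index [:: k; i; j; m] isT.
have [b bP] := @fresh_index [:: i; j; m; a] isT.
rewrite (@left_unitE k i a); last by distinct.
rewrite (@left_unitE j m b); last by distinct.
rewrite smulA -[offdiag_unit k a ** _ ** _]smulA; case: eqVneq => [ij|ij].
  rewrite -ij in aP bP *; rewrite (@offdiag_unitM a i b); last by distinct.
  rewrite -smulA (@offdiag_unitM a b m); last by distinct.
  by rewrite -left_unitE//; distinct.
by rewrite offdiag_unit_mul0 ?smul0r ?smul0l//; distinct.
Qed.

Lemma left_unit_mulv0 k r i j : uniq [:: r; i; j] -> left_unit k r ** v i j = 0.
Proof.
move=> u; have [a aP] := @fresh_index [:: k; r] isT.
by rewrite (left_unitE aP) -smulA offdiag_unit_mulv0 ?smul0r//; distinct.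
Qed.

(** In v_rj = v_ij v_il^* v_rl + v_rl v_il^* v_ij the left unit E_kr kills the first summand, and
    v_rl v_il^* = E_ri turns the second into E_ki v_ij. *)
Lemma left_unit_mulv k i j r : i != j -> r != j ->
  left_unit k i ** v i j = left_unit k r ** v r j.
Proof.
have [->//|ir] := eqVneq i r; move=> ij rj.
have [l lP] := @fresh_index [:: i; j; r] isT.
have u : uniq [:: i; j; r; l] by distinct.
rewrite -(symp_quadrangle vG u) /sternary smulDr !smulA.
rewrite (@left_unit_mulv0 k r i j); last by distinct.
rewrite !smul0l add0r -[left_unit k r ** _ ** _]smulA.
rewrite -(@offdiag_unitE r i l); last by distinct.
by rewrite -left_unit_offdiag 1?eq_sym// left_unitM eqxx.
Qed.

(** In the model, E_ki (E_ij - E_ji) = E_kj for every i other than j; the case k = j is included. *)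
Definition symp_unit k j : V :=
  let i := fresh_elt [:: j] k in left_unit k i ** v i j.

Lemma symp_unitE k j i : i != j -> symp_unit k j = left_unit k i ** v i j.
Proof.
move=> ij; apply: left_unit_mulv => //.
by have := @fresh_notin [:: j] k isT; rewrite inE.
Qed.

(** Places the unit inside every TRO that contains the grid. *)
Lemma symp_unit_sternary k l i j : uniq [:: k; l; i] -> i != j ->
  symp_unit k j = sternary (v k l) (v i l) (v i j).
Proof.
move=> u ij; rewrite (symp_unitE _ ij) left_unit_offdiag; last by distinct.
by rewrite (@offdiag_unitE k i l)//; distinct.
Qed.

(** The two summands of the quadrangle relation for v_kj are the two units; reversing three index
    pairs produces the minus sign. *)
Lemma symp_unitB k j : k != j -> v k j = symp_unit k j - symp_unit j k.
Proof.
move=> kj; have [l lP] := @fresh_index [:: k; j] isT.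
have [i iP] := @fresh_index [:: k; j; l] isT.
have u : uniq [:: i; j; k; l] by distinct.
rewrite -(symp_quadrangle vG u) addrC (@symp_unit_sternary k l i j); try by distinct.
rewrite (@symp_unit_sternary j i l k); try by distinct.
congr (_ + _); rewrite (@symp_opp _ _ _ _ vG j i); last by distinct.
rewrite (@symp_opp _ _ _ _ vG l i); last by distinct.
rewrite (@symp_opp _ _ _ _ vG l k); last by distinct.
by rewrite /sternary sstarN !(smulNl, smulNr) opprK.
Qed.

Lemma symp_unit_units : matrix_units symp_unit.
Proof.
(* With distinct auxiliary i and a, the inner product v_ij v_al^* is the left unit E_ia if j = l and
   vanishes by orthogonality otherwise. *)
have ee k j m l : symp_unit k j ** (symp_unit m l)^' =
    if j == l then left_unit k m else 0.
  have [i iP] := @fresh_index [:: j; l] isT.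
  have [a aP] := @fresh_index [:: j; l; i] isT.
  rewrite (@symp_unitE k j i); last by distinct.
  rewrite (@symp_unitE m l a); last by distinct.
  rewrite sstarM left_unit_star smulA -[left_unit k i ** _ ** _]smulA.
  case: eqVneq => [jl|jl].
    rewrite -jl -(@offdiag_unitE i a j); last by distinct.
    rewrite -left_unit_offdiag; last by distinct.
    by rewrite left_unitM eqxx left_unitM eqxx.
  by rewrite symp_orthogonal_r ?smul0r ?smul0l//; distinct.
move=> k j m l p q; rewrite /sternary ee.
case: (eqVneq j l) => _ /=; last by rewrite smul0l.
have [r rP] := @fresh_index [:: q] isT.
rewrite (@symp_unitE p q r) ?[LHS]smulA ?left_unitM; last by distinct.
case: (eqVneq m p) => _; last by rewrite smul0l.
by rewrite -symp_unitE//; distinct.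
Qed.

End SymplecticGrid.

(** * Linear combinations of ternary matrix units *)

Section MatrixUnits.
Context {K : numClosedFieldType} {V : starAlgType K} {n : nat}.
Context (e : 'I_n -> 'I_n -> V).
Implicit Types M N P : 'M[K]_n.

Definition mx_comb M : V := \sum_i \sum_j M i j *: e i j.

Lemma mx_comb_is_linear : linear mx_comb.
Proof.
move=> a M N; rewrite /mx_comb scaler_sumr -big_split; apply: eq_bigr => i _ /=.
rewrite scaler_sumr -big_split; apply: eq_bigr => j _ /=.
by rewrite !mxE scalerDl scalerA.
Qed.
HB.instance Definition _ := GRing.isLinear.Build K 'M[K]_n V *:%R mx_comb
  mx_comb_is_linear.

Lemma mx_comb_delta i j : mx_comb (delta_mx i j) = e i j.
Proof.
rewrite /mx_comb (bigD1 i)//= (bigD1 j)//= mxE !eqxx scale1r !big1 ?addr0//.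
  by move=> k ki; apply: big1 => l _; rewrite mxE (negbTE ki) scale0r.
by move=> l lj; rewrite mxE (negbTE lj) andbF scale0r.
Qed.

Context (eU : matrix_units e).

Lemma mx_comb_sternary M N P :
  sternary (mx_comb M) (mx_comb N) (mx_comb P) =
  mx_comb (M *m map_mx Num.conj N^T *m P).
Proof.
rewrite [LHS](_ : _ = \sum_i \sum_j \sum_k \sum_l \sum_p \sum_q
   (M i j * (N k l)^* * P p q) *: sternary (e i j) (e k l) (e p q)); last first.
  rewrite /sternary /mx_comb sstar_sum !smul_suml; apply: eq_bigr => i _.
  rewrite !smul_suml; apply: eq_bigr => j _.
  rewrite smul_sumr smul_suml; apply: eq_bigr => k _.
  rewrite sstar_sum smul_sumr smul_suml; apply: eq_bigr => l _.
  rewrite smul_sumr; apply: eq_bigr => p _.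
  rewrite smul_sumr; apply: eq_bigr => q _.
  by rewrite sstarZ !(smulZl, smulZr) !scalerA [in RHS]mulrC mulrA.
(* Of the sixfold sum only the terms with l = j and p = k survive. *)
apply: eq_bigr => i _; rewrite (exchange_big_dep xpredT)//=.
under eq_bigr => k _.
  under eq_bigr => j _.
    rewrite (bigD1 j)//= (bigD1 k)//= [X in _ + X + _]big1; last first.
      by move=> p pk; apply: big1 => q _; rewrite eU eqxx eq_sym (negbTE pk) scaler0.
    rewrite [X in _ + X]big1; last first.
      move=> l lj; apply: big1 => p _; apply: big1 => q _.
      by rewrite eU eq_sym (negbTE lj) scaler0.
    rewrite !addr0.
    under eq_bigr do rewrite eU !eqxx /=.
    over.
  rewrite exchange_big; over.
rewrite exchange_big; apply: eq_bigr => q _ /=.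
rewrite mxE scaler_suml; apply: eq_bigr => k _.
rewrite mxE mulr_suml scaler_suml; apply: eq_bigr => j _.
by rewrite !mxE.
Qed.

(** Since E_ik M E_lj = M_kl E_ij, a combination that vanishes has M_kl e_ij = 0 for all k and l.
    Taking the identity matrix in the middle expresses matrix products by ternary ones. *)
Lemma mx_comb_inj i j : e i j != 0 -> injective mx_comb.
Proof.
move=> eij; apply: raddf_inj => M M0; apply/matrixP => k l.
have combM N P : mx_comb (N *m P) = sternary (mx_comb N) (mx_comb 1%:M) (mx_comb P).
  by rewrite mx_comb_sternary trmx1 map_mx1 mulmx1.
have := combM (delta_mx i k *m M) (delta_mx l j).
rewrite (combM _ M) M0 {2}/sternary smul0r /sternary !smul0l.
rewrite [X in mx_comb X](_ : _ = M k l *: delta_mx i j).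
  by move/eqP; rewrite linearZ/= mx_comb_delta scaler_eq0 (negbTE eij) orbF mxE => /eqP.
apply/matrixP => a b; rewrite !mxE (bigD1 l)//= [X in _ + X]big1; last first.
  by move=> m ml; rewrite !mxE (negbTE ml) mulr0.
rewrite addr0 !mxE (bigD1 k)//= [X in _ + X]big1; last first.
  by move=> m mk; rewrite !mxE (negbTE mk) andbF mul0r.
rewrite !mxE !eqxx andbT !addr0.
by do 2![case: eqP => _]; rewrite /= ?(mul1r, mulr1, mulr0, mul0r).
Qed.

End MatrixUnits.

(** * Riesz representation and adjoints *)

Section HilbertTheory.
Context {R : realType} {H : hilbertType R}.
Local Notation C := R[i].
Local Notation "x ^*" := (Num.conj x) : ring_scope.
Implicit Types (x y z w : H) (a b : C).

Lemma hdotC x y : hdot H x y = (hdot H y x)^*.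
Proof. by rewrite [LHS]hermC expr0 mul1r. Qed.

Lemma hdotDl x y z : hdot H (x + y) z = hdot H x z + hdot H y z.
Proof. exact: linearDl. Qed.

Lemma hdotDr x y z : hdot H z (x + y) = hdot H z x + hdot H z y.
Proof. exact: linearDr. Qed.

Lemma hdotZl a x z : hdot H (a *: x) z = a * hdot H x z.
Proof. exact: linearZl_LR. Qed.

Lemma hdotZr a x z : hdot H z (a *: x) = a^* * hdot H z x.
Proof. exact: linearZr_LR. Qed.

Lemma hdotBl x y z : hdot H (x - y) z = hdot H x z - hdot H y z.
Proof. exact: linearBl. Qed.

Lemma hdotBr x y z : hdot H z (x - y) = hdot H z x - hdot H z y.
Proof. exact: linearBr. Qed.

Lemma hdot0l z : hdot H 0 z = 0.
Proof. exact: linear0l. Qed.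

Lemma hdot_inj y z : (forall x, hdot H x y = hdot H x z) -> y = z.
Proof.
move=> yz; apply/eqP; rewrite -subr_eq0 -normr_eq0 -sqrf_eq0 hdot_norm.
by rewrite hdotBr yz subrr.
Qed.

Lemma hdot_Cauchy_Schwarz x y : `|hdot H x y| <= `|x| * `|y|.
Proof.
have [->|y0] := eqVneq y 0.
  by rewrite normr0 mulr0 hdotC hdot0l rmorph0 normr0.
have : 0 <= `|hdot H y y *: x - hdot H x y *: y| ^+ 2 by rewrite exprn_ge0.
rewrite hdot_norm hdotBl !hdotBr !hdotZl !hdotZr -!hdot_norm.
rewrite (hdotC y x); set c := hdot H x y; set n := `|y| ^+ 2; set m := `|x| ^+ 2.
have n0 : 0 < n by rewrite exprn_gt0// normr_gt0.
have -> : n^* = n by rewrite geC0_conj// ltW.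
rewrite (_ : _ - _ = n * (m * n - c * c^*)); last by ring.
by rewrite pmulr_rge0// subr_ge0 -normCK -exprMn ler_sqr// ?nnegrE ?mulr_ge0 ?normr_ge0.
Qed.

(* J x = |x|^2 - 2 Re (phi x) is minimised at the representing vector; a
   minimising filter is Cauchy by the parallelogram law. *)
Section Riesz.
Context (phi : H -> C) (phi_lin : forall a x y, phi (a *: x + y) = a * phi x + phi y).
Context (M : C) (phi_bd : forall x, `|phi x| <= M * `|x|).

Let J x : C := `|x| ^+ 2 - (phi x + (phi x)^*).

(** A descent step: g is the defect of x in representing [phi] at w, and the move changes J by
    exactly -2s|g|^2 + s^2|g|^2|w|^2. *)
Lemma riesz_shift x w (s g : C) : 0 <= s -> s * `|w| ^+ 2 <= 1 ->
  g = hdot H w x - phi w ->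
  J (- (s * g^*) *: w + x) <= J x - s * `|g| ^+ 2.
Proof.
move=> s0 sw gE; rewrite /J phi_lin !hdot_norm hdotDl !hdotDr !hdotZl !hdotZr.
rewrite (hdotC x w) rmorphD !rmorphM /= !rmorphN /= !rmorphM /= conjCK (geC0_conj s0).
rewrite -!hdot_norm normCK -subr_ge0.
rewrite [leRHS](_ : _ = s * (g * g^*) * (1 - s * `|w| ^+ 2)); last first.
  by rewrite gE rmorphB /=; ring.
by rewrite -normCK mulr_ge0 ?subr_ge0// mulr_ge0// exprn_ge0.
Qed.

Lemma riesz_midpoint x y :
  `|x - y| ^+ 2 = 2 * J x + 2 * J y - 4 * J (2^-1 *: (x + y)).
Proof.
have phiD u v : phi (u + v) = phi u + phi v by rewrite -[u in LHS]scale1r phi_lin mul1r.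
have phi0 : phi 0 = 0 by apply: (addrI (phi 0)); rewrite -phiD !addr0.
have phiZ a u : phi (a *: u) = a * phi u by rewrite -[a *: u]addr0 phi_lin phi0 addr0.
have half : (2^-1 : C)^* = 2^-1 by rewrite geC0_conj// invr_ge0 ler0n.
rewrite /J phiZ phiD !hdot_norm hdotZl hdotZr hdotBl !hdotBr hdotDl !hdotDr.
rewrite !(rmorphD, rmorphM)/= half.
by field.
Qed.

(** Completing the square: J x >= |x|^2 - 2|M||x| = (|x| - |M|)^2 - |M|^2. *)
Lemma riesz_bounded_below x : - `|M| ^+ 2 <= J x.
Proof.
have pM : `|phi x| <= `|M| * `|x|.
  apply: (le_trans (phi_bd x)); rewrite -[`|x| in leRHS]normr_id -normrM.
  by apply: real_ler_norm; apply: ger0_real; exact: le_trans (phi_bd x).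
have : `|phi x + (phi x)^*| <= 2 * (`|M| * `|x|).
  by rewrite (le_trans (ler_normD _ _))// norm_conjC -mulr2n mulr_natl lerMn2r.
have pr : phi x + (phi x)^* \is Num.real.
  by rewrite CrealE rmorphD/= conjCK addrC.
move=> /(le_trans (real_ler_norm pr)) px.
apply: (@le_trans _ _ (`|x| ^+ 2 - 2 * (`|M| * `|x|))); last by rewrite lerD2l lerN2.
rewrite -subr_ge0 (_ : _ - _ = (`|x| - `|M|) ^+ 2); last by ring.
by rewrite real_exprn_even_ge0// rpredB ?normr_real.
Qed.

Let J_real x : J x = (complex.Re (J x))%:C%C.
Proof.
by rewrite RRe_real// rpredB// ?rpredX// ?normr_real// CrealE rmorphD/= conjCK addrC.
Qed.

Lemma riesz : exists z, forall x, phi x = hdot H x z.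
Proof.
(* The order of [R[i]] is partial, so the infimum is taken in [R] over real parts; [J_real]
   translates back. *)
pose S := range (fun x => complex.Re (J x)); pose d := inf S.
have Slb : lbound S (complex.Re (- `|M| ^+ 2)).
  move=> _ [x _ <-].
  by have := riesz_bounded_below x; rewrite lecE => /andP[].
have hS : has_inf S.
  by split; [exists (complex.Re (J 0)), 0 | exists (complex.Re (- `|M| ^+ 2))].
have dJ x : d%:C%C <= J x.
  by rewrite J_real lecR; apply: ge_inf; [case: hS | exists x].
pose B (r : R) := [set x | J x < (d + r)%:C%C].
have B0 r : 0 < r -> B r !=set0.
  move=> r0; have [_ [x _ <-] xd] := inf_adherent r0 hS.
  by exists x; rewrite /B/= J_real ltcR.
pose F := filter_from [set r : R | 0 < r] B.
have FF : ProperFilter F.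
  apply: filter_from_proper => //.
  apply: filter_from_filter; first by exists 1; exact: ltr01.
  move=> r r' r0 r0'; exists (Num.min r r'); first by rewrite /= lt_min r0.
  by move=> x; rewrite /B /= J_real !ltcR -!ltrBlDl lt_min => /andP[].
have cF : cvg F.
  apply: cauchy_cvg; apply/cauchyP => eps eps0.
  have epsE : eps = (complex.Re eps)%:C%C by rewrite RRe_real// gtr0_real.
  have e0 : 0 < complex.Re eps by rewrite -ltcR -epsE.
  (* For x and y with J below d + r, the midpoint identity gives |x - y|^2 < 4(d + r) - 4d =
     eps^2. *)
  pose r := (complex.Re eps) ^+ 2 / 4.
  have r0 : 0 < r by rewrite divr_gt0// exprn_gt0.
  have [x xr] := B0 _ r0; exists x; exists r => // y yr.
  rewrite -ball_normE /ball_/= -(@ltr_sqr _ `|_|) ?nnegrE// ?(ltW eps0)//.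
  rewrite riesz_midpoint.
  have := dJ (2^-1 *: (x + y)); move: xr yr; rewrite /B /= [eps]epsE.
  rewrite (J_real x) (J_real y) (J_real (_ *: _)) -rmorphXn.
  rewrite -!(rmorph_nat (real_complex R)).
  rewrite -!rmorphM -rmorphD -rmorphB !ltcR lecR /r; lra.
pose z := lim F; exists z => w.
have zP eps r : 0 < eps -> 0 < r -> exists2 x, J x < (d + r)%:C%C & `|z - x| < eps.
  move=> eps0 r0; have [r1 r10 r1z] : F (ball z eps) by apply: cF; exact: nbhsx_ballx.
  have [|x] := B0 (Num.min r r1); first by rewrite lt_min r0.
  rewrite /B /= => xr; exists x.
    by move: xr; rewrite J_real !ltcR -!ltrBlDl lt_min => /andP[].
  have := r1z x; rewrite -ball_normE /ball_/=; apply.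
  by rewrite /B /=; move: xr; rewrite J_real !ltcR -!ltrBlDl lt_min => /andP[].
apply/eqP; rewrite -subr_eq0 -oppr_eq0 opprB; set g := _ - _.
apply/negPn/negP => g0; have a0 : 0 < `|g| by rewrite normr_gt0.
pose s : C := (1 + `|w| ^+ 2)^-1.
have q0 : 0 < 1 + `|w| ^+ 2 by rewrite ltr_wpDr ?exprn_ge0.
have s0 : 0 < s by rewrite invr_gt0.
have sw : s * `|w| ^+ 2 <= 1 by rewrite mulrC ler_pdivrMr// mul1r lerDr.
have w0 : 0 < 1 + `|w| by rewrite ltr_wpDr.
(* A point x close enough to z still has defect at least |g|/2, so a descent step lowers J by at
   least r. If J x < d + r as well, this goes below the infimum. *)
pose r := s * (`|g| / 2) ^+ 2.
have r0 : 0 < r by rewrite mulr_gt0// exprn_gt0// divr_gt0.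
have rE : r = (complex.Re r)%:C%C by rewrite RRe_real// gtr0_real.
have [||x xr xz] := zP (`|g| / 2 / (1 + `|w|)) (complex.Re r).
- by rewrite !divr_gt0.
- by rewrite -ltcR -rE.
pose gx := hdot H w x - phi w.
have ggx : `|g| / 2 <= `|gx|.
  have : `|g - gx| <= `|g| / 2.
    rewrite /g /gx opprB addrA subrK -hdotBr (le_trans (hdot_Cauchy_Schwarz _ _))//.
    apply: (@le_trans _ _ (`|w| * (`|g| / 2 / (1 + `|w|)))).
      by rewrite ler_wpM2l// ltW.
    rewrite mulrCA ler_piMr// ?divr_ge0// ler_pdivrMr// mul1r lerDr ler01//.
  move=> h; have := le_trans (lerB_dist _ _) h; rewrite lerBlDl.
  by rewrite -lerBlDr {1}[`|g|]splitr addrK.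
have := le_trans (dJ _) (riesz_shift (ltW s0) sw (erefl gx)).
rewrite lerBrDr => h; have := lt_le_trans (le_lt_trans h xr).
move=> /(_ (d%:C%C + r)); rewrite rmorphD /= -rE => /(_ (lexx _)).
rewrite ltrD2l /r ltr_pM2l// => /lt_geF; rewrite ler_sqr ?nnegrE ?divr_ge0//.
by rewrite ggx.
Qed.

End Riesz.
End HilbertTheory.

(** * The star algebra of adjointable operators *)

Section AdjointableOperators.
Context {R : realType} {H : hilbertType R}.
Local Notation C := R[i].
Local Notation "x ^*" := (Num.conj x) : ring_scope.
Implicit Types (x y z : H) (a : C) (f g : H -> H).

(** Asking for an adjoint outright makes the class closed under products and adjoints with no norm
    estimates. *)
Definition adjointable : {pred H -> H} := fun f =>
  `[< linear f /\ exists g : H -> H, forall x y, hdot H (f x) y = hdot H x (g y) >].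

Lemma adjointP f g : (forall x y, hdot H (f x) y = hdot H x (g y)) -> adjoint f = g.
Proof.
move=> fg; apply/funext => y; rewrite /adjoint; apply: hdot_inj => x.
by case: xgetP => [z _ <-|/(_ (g y))/=]; [rewrite fg | case].
Qed.

Lemma adjointableP f : f \in adjointable ->
  forall x y, hdot H (f x) y = hdot H x (adjoint f y).
Proof. by move=> /asboolP[_ [g fg]] x y; rewrite (adjointP fg). Qed.

Lemma adjointable_linear f : f \in adjointable -> linear f.
Proof. by move=> /asboolP[]. Qed.

(** Riesz applied to the functional x |-> (f x, y), whose bound is M|y|. *)
Lemma adjointable_bounded f : bounded_operator f -> f \in adjointable.
Proof.
move=> [lf [M fM]]; apply/asboolP; split=> //.
suff /choice[g gP] : forall y, exists z, forall x, hdot H (f x) y = hdot H x z.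
  by exists g.
move=> y; apply: (@riesz _ _ (fun x => hdot H (f x) y) _ (M * `|y|)) => [a x x'|x].
  by rewrite lf hdotDl hdotZl.
by rewrite (le_trans (hdot_Cauchy_Schwarz _ _))// mulrAC ler_wpM2r.
Qed.

Lemma adjoint_linear f : f \in adjointable -> linear (adjoint f).
Proof.
move=> /adjointableP fP a x y; apply: hdot_inj => z.
by rewrite -fP !hdotDr !hdotZr !fP.
Qed.

Lemma adjoint_adjointable f : f \in adjointable -> adjoint f \in adjointable.
Proof.
move=> af; apply/asboolP; split; first exact: adjoint_linear.
by exists f => x y; rewrite hdotC -(adjointableP af) -hdotC.
Qed.

Lemma adjointK f : f \in adjointable -> adjoint (adjoint f) = f.
Proof.
by move=> af; apply: adjointP => x y; rewrite hdotC -(adjointableP af) -hdotC.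
Qed.

Lemma comp_adjointable f g : f \in adjointable -> g \in adjointable ->
  f \o g \in adjointable.
Proof.
move=> af ag; apply/asboolP; split=> [a x y|].
  by rewrite /= (adjointable_linear ag) (adjointable_linear af).
by exists (adjoint g \o adjoint f) => x y /=; rewrite !adjointableP.
Qed.

Lemma adjoint_comp f g : f \in adjointable -> g \in adjointable ->
  adjoint (f \o g) = adjoint g \o adjoint f.
Proof. by move=> af ag; apply: adjointP => x y /=; rewrite !adjointableP. Qed.

Lemma adjointable_submod : submod_closed adjointable.
Proof.
split=> [|a f g af ag].
  apply/asboolP; split=> [a x y|]; first by rewrite scaler0 addr0.
  by exists 0 => x y; rewrite hdot0l hdotC hdot0l rmorph0.
apply/asboolP; split=> [b x y|].
  rewrite /= !fctE (adjointable_linear ag) (adjointable_linear af).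
  by rewrite !scalerDr !scalerA (mulrC a) addrACA.
exists (fun y => a^* *: adjoint f y + adjoint g y) => x y.
by rewrite hdotDl hdotZl hdotDr hdotZr conjCK !adjointableP.
Qed.
HB.instance Definition _ := GRing.isSubmodClosed.Build C (H -> H) adjointable
  adjointable_submod.

Record adjop := AdjOp { adjop_fun : H -> H; adjopP : adjop_fun \in adjointable }.
HB.instance Definition _ := [isSub for adjop_fun].
HB.instance Definition _ := [Choice of adjop by <:].
HB.instance Definition _ := [SubChoice_isSubLmodule of adjop by <:].

Definition adjop_mul (f g : adjop) := AdjOp (comp_adjointable (adjopP f) (adjopP g)).
Definition adjop_star (f : adjop) := AdjOp (adjoint_adjointable (adjopP f)).

Fact adjop_mulA : associative adjop_mul.
Proof. by move=> f g h; apply: val_inj. Qed.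

Fact adjop_mul_linearl a (f g h : adjop) :
  adjop_mul (a *: f + g) h = a *: adjop_mul f h + adjop_mul g h.
Proof. by apply: val_inj; rewrite /= !fctE. Qed.

Fact adjop_mul_linearr a (f g h : adjop) :
  adjop_mul h (a *: f + g) = a *: adjop_mul h f + adjop_mul h g.
Proof.
apply: val_inj; apply/funext => x /=; rewrite !fctE /=.
by rewrite (adjointable_linear (adjopP h)).
Qed.

Fact adjop_starK : involutive adjop_star.
Proof. by move=> f; apply: val_inj => /=; rewrite adjointK// adjopP. Qed.

Fact adjop_star_antilinear a (f g : adjop) :
  adjop_star (a *: f + g) = a^* *: adjop_star f + adjop_star g.
Proof.
apply: val_inj; apply: adjointP => x y /=; rewrite !fctE /=.
by rewrite hdotDl hdotZl hdotDr hdotZr conjCK !adjointableP ?adjopP.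
Qed.

Fact adjop_starM (f g : adjop) :
  adjop_star (adjop_mul f g) = adjop_mul (adjop_star g) (adjop_star f).
Proof. by apply: val_inj; rewrite /= adjoint_comp ?adjopP. Qed.

Definition adjop_starAlg : starAlgType C := StarAlg adjop_mulA adjop_mul_linearl
  adjop_mul_linearr adjop_starK adjop_star_antilinear adjop_starM.

Lemma adjop_sternary (f g h : adjop_starAlg) :
  adjop_fun (sternary f g h) = op_ternary (adjop_fun f) (adjop_fun g) (adjop_fun h).
Proof. by []. Qed.

End AdjointableOperators.

(** * Norm-closed spans of matrix units in B(H) *)

Section MatrixUnitOperators.
Context {R : realType} {H : hilbertType R} {n : nat}.
Local Notation C := R[i].
Local Notation "x ^*" := (Num.conj x) : ring_scope.
Context (e : 'I_n -> 'I_n -> @adjop_starAlg R H) (eU : matrix_units e).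
Context (e_bounded : forall i j, bounded_operator (adjop_fun (e i j))).

Definition unit_span : set (H -> H) := range (fun M => adjop_fun (mx_comb e M)).

Lemma mx_comb_app (M : 'M[C]_n) x :
  adjop_fun (mx_comb e M) x = \sum_i \sum_j M i j *: adjop_fun (e i j) x.
Proof.
pose ev (f : @adjop_starAlg R H) := adjop_fun f x.
have evM : {morph ev : f g / f + g} by move=> f g.
rewrite /mx_comb -/(ev _) (big_morph ev evM (erefl _)); apply: eq_bigr => i _.
by rewrite (big_morph ev evM (erefl _)).
Qed.

Lemma mx_comb_bounded (M : 'M[C]_n) : bounded_operator (adjop_fun (mx_comb e M)).
Proof.
split; first exact: adjointable_linear (adjopP _).
have /(_ _)/cid-/all_sig[B eB] := fun p => (e_bounded p.1 p.2).2.
exists (\sum_i \sum_j `|M i j| * B (i, j)) => x.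
rewrite mx_comb_app mulr_suml (le_trans (ler_norm_sum _ _ _))//.
apply: ler_sum => i _; rewrite mulr_suml (le_trans (ler_norm_sum _ _ _))//.
apply: ler_sum => j _; rewrite normrZ -mulrA ler_wpM2l//.
exact: (eB (i, j)).
Qed.

(** The coefficients of a combination are matrix coefficients (T x, y) for suitable vectors, hence
    continuous in T. Evaluated at a limit f they give a matrix [N], whose combination must be f. *)
Lemma unit_span_closed a b : e a b != 0 -> op_norm_closed unit_span.
Proof.
move=> eab f [lf _] fT.
have [xi xi0] : exists xi, adjop_fun (e a b) xi != 0.
  apply: contrapT => /forallNP ab0; move/negP: eab; apply; apply/eqP/val_inj.
  by apply/funext => x; apply/eqP/negPn/negP; exact: ab0.
(* The unit relations give e_kl ket_j = [l = j] bra_k, and the bra_k are pairwise orthogonal of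
   squared norm c. *)
pose ket j := adjoint (adjop_fun (e a j)) (adjop_fun (e a b) xi).
pose bra k := adjop_fun (e k b) xi.
pose c := `|adjop_fun (e a b) xi| ^+ 2.
have c0 : 0 < c by rewrite exprn_gt0// normr_gt0.
have e_ket k l j : adjop_fun (e k l) (ket j) = if l == j then bra k else 0.
  have /(congr1 (fun g => adjop_fun g xi)) := eU k l a j a b.
  by rewrite eqxx andbT; case: ifP.
have bra_bra k i : hdot H (bra k) (bra i) = if k == i then c else 0.
  have kE : bra k =
      adjop_fun (e k b) (adjoint (adjop_fun (e a b)) (adjop_fun (e a b) xi)).
    have /(congr1 (fun g => adjop_fun g xi)) := eU k b a b a b.
    by rewrite !eqxx /= => /esym.
  rewrite kE (adjointableP (adjopP _)) (adjointableP (adjoint_adjointable (adjopP _))).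
  rewrite adjointK ?adjopP//.
  have /(congr1 (fun g => adjop_fun g xi)) := eU a b k b i b.
  rewrite eqxx /= => ->; case: ifP => _; first by rewrite -hdot_norm.
  by rewrite hdotC hdot0l rmorph0.
have coef (M : 'M[C]_n) k j :
    hdot H (adjop_fun (mx_comb e M) (ket j)) (bra k) = M k j * c.
  rewrite mx_comb_app.
  under eq_bigr => i _ do under eq_bigr => l _ do rewrite e_ket.
  rewrite (_ : \sum_i _ = \sum_i M i j *: bra i); last first.
    apply: eq_bigr => i _; rewrite (bigD1 j)//= eqxx big1 ?addr0// => l lj.
    by rewrite (negbTE lj) scaler0.
  have hM : {morph (fun x => hdot H x (bra k)) : x y / x + y}.
    by move=> x y; rewrite hdotDl.
  rewrite (big_morph _ hM (hdot0l _)) (bigD1 k)//= hdotZl bra_bra eqxx.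
  rewrite big1 ?addr0// => i ik.
  by rewrite hdotZl bra_bra (negbTE ik) mulr0.
pose N := \matrix_(k, j) (hdot H (f (ket j)) (bra k) / c); exists N => //.
apply/funext => w; apply/eqP; rewrite -subr_eq0 -normr_eq0.
(* An approximation of f within eps has coefficients within eps |ket_j| |bra_k| / c of those of [N];
   L collects these errors at w. *)
pose L := \sum_k \sum_j `|ket j| * `|bra k| / c * `|adjop_fun (e k j) w|.
have L0 : 0 <= L.
  by do 2!apply: sumr_ge0 => ? _; rewrite !mulr_ge0// invr_ge0 ltW.
have key eps : 0 < eps -> `|adjop_fun (mx_comb e N) w - f w| <= eps * (L + `|w|).
  move=> eps0; have [_ [M _ <-] gM] := fT _ eps0.
  rewrite -(subrK (adjop_fun (mx_comb e M) w) (adjop_fun (mx_comb e N) w)) -addrA.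
  rewrite (le_trans (ler_normD _ _))// mulrDr lerD//; last by rewrite distrC.
  rewrite !mx_comb_app -sumrB mulr_sumr (le_trans (ler_norm_sum _ _ _))//.
  apply: ler_sum => k _; rewrite -sumrB mulr_sumr (le_trans (ler_norm_sum _ _ _))//.
  apply: ler_sum => j _; rewrite -scalerBl normrZ mulrA ler_wpM2r//.
  have -> : M k j = hdot H (adjop_fun (mx_comb e M) (ket j)) (bra k) / c.
    by rewrite coef mulfK ?gt_eqF.
  rewrite mxE -mulrBl -hdotBl normrM normfV (gtr0_norm c0) mulrA.
  rewrite ler_wpM2r ?invr_ge0 ?(ltW c0)//.
  by rewrite (le_trans (hdot_Cauchy_Schwarz _ _))// mulrA ler_wpM2r.
apply/negPn/negP => nz; set t := `|_| in nz key.
have t0 : 0 < t by rewrite lt_def nz /t normr_ge0.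
have q0 : 0 < L + `|w| + 1 by rewrite ltr_wpDl// addr_ge0.
(* This eps would give t <= t (L + |w|) / (L + |w| + 1) < t. *)
have := key (t / (L + `|w| + 1)) (divr_gt0 t0 q0).
by rewrite mulrAC ler_pdivlMr// ler_pM2l// gerDl lt_geF ?ltr01.
Qed.

Lemma unit_span_TRO a b : e a b != 0 -> is_TRO unit_span.
Proof.
move=> eab; split; last 2 first.
- exact: unit_span_closed eab.
- move=> _ _ _ [L _ <-] [M _ <-] [N _ <-].
  by rewrite -adjop_sternary (mx_comb_sternary eU); eexists.
- by move=> _ [M _ <-]; exact: mx_comb_bounded.
split; first by exists 0; rewrite ?linear0.
by move=> t _ _ [M _ <-] [N _ <-]; exists (t *: M + N); rewrite ?linearP.
Qed.

End MatrixUnitOperators.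

(** * The Hilbert space of dimension n *)

(* A copy of 'rV carrying the l^2 norm, since 'rV itself carries the sup norm. *)
Definition ell2 (R : realType) (n : nat) : Type := 'rV[R[i]]_n.

Section Ell2.
Context {R : realType} {n : nat}.
Local Notation C := R[i].
Local Notation "x ^*" := (Num.conj x) : ring_scope.
HB.instance Definition _ := GRing.Lmodule.copy (ell2 R n) 'rV[R[i]]_n.
Implicit Types (x y : ell2 R n).

Definition ell2_dot : {dot ell2 R n for Num.conj} := @dotmx R[i] n.
Definition ell2_norm x : C := sqrtC (ell2_dot x x).

Fact ell2_normD x y : ell2_norm (x + y) <= ell2_norm x + ell2_norm y.
Proof. by have [] := triangle_lerif (@dotmx R[i] n) x y. Qed.

Fact ell2_normZ (a : C) x : ell2_norm (a *: x) = `|a| * ell2_norm x.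
Proof.
rewrite /ell2_norm (dnormZ (@dotmx R[i] n)) sqrtCM ?nnegrE ?exprn_ge0//.
by rewrite sqrCK.
Qed.

Fact ell2_norm_eq0 x : ell2_norm x = 0 -> x = 0.
Proof. by move=> /eqP; rewrite (sqrt_dnorm_eq0 (@dotmx R[i] n)) => /eqP. Qed.

HB.instance Definition _ := Lmodule_isNormed.Build C (ell2 R n)
  ell2_normD ell2_normZ ell2_norm_eq0.

Lemma ell2_dotE x y : ell2_dot x y = \sum_j x 0 j * (y 0 j)^*.
Proof. by rewrite /ell2_dot /= dotmxE mxE; apply: eq_bigr => j _; rewrite !mxE. Qed.

Lemma ell2_norm_sqr x : `|x| ^+ 2 = ell2_dot x x.
Proof. by rewrite [`|x|]/(ell2_norm x) sqrtCK. Qed.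

Lemma ell2_coord_le x j : `|x 0 j| <= `|x|.
Proof.
rewrite -ler_sqr ?nnegrE// ell2_norm_sqr ell2_dotE (bigD1 j)//= -normCK lerDl.
by apply: sumr_ge0 => k _; rewrite -normCK exprn_ge0.
Qed.

Lemma ell2_norm_le x : `|x| <= \sum_j `|x 0 j|.
Proof.
rewrite -ler_sqr ?nnegrE ?sumr_ge0// ell2_norm_sqr ell2_dotE expr2 mulr_suml.
apply: ler_sum => j _; rewrite -normCK expr2 ler_wpM2l//.
by rewrite (bigD1 j)//= lerDl sumr_ge0.
Qed.

(* add_Re2_Im2 with the norm of the canonical structure on R[i]. *)
Lemma sqr_normC (a : C) :
  `|a| ^+ 2 = (complex.Re a ^+ 2 + complex.Im a ^+ 2)%:C%C.
Proof. exact: esym (add_Re2_Im2 a). Qed.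

Lemma normC_le_Re_Im (a : C) : `|a| <= (`|complex.Re a| + `|complex.Im a|)%:C%C.
Proof.
rewrite -ler_sqr ?nnegrE// ?ler0c ?addr_ge0// sqr_normC -rmorphXn lecR.
rewrite sqrrD !real_normK ?num_real// addrAC lerDl mulrn_wge0// mulr_ge0//.
Qed.

Lemma normC_ge_Im (a : C) : (`|complex.Im a|)%:C%C <= `|a|.
Proof.
rewrite -ler_sqr ?nnegrE// ?ler0c// sqr_normC -rmorphXn lecR.
by rewrite real_normK ?num_real// lerDr sqr_ge0.
Qed.

(** Real and imaginary parts of each coordinate converge in [R]; the l^2 norm is at most the sum of
    the moduli of the coordinates. *)
Lemma ell2_complete (F : set_system (ell2 R n)) : ProperFilter F -> cauchy F -> cvg F.
Proof.
move=> FF /cauchyP cF.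
have lim1 (p : C -> R) : (forall a b, p (a - b) = p a - p b) ->
    (forall a, (`|p a|)%:C%C <= `|a|) ->
    exists l : 'I_n -> R, forall j (eps : R), 0 < eps ->
      F [set x : ell2 R n | `|l j - p (x 0 j)| < eps].
  move=> pB pN.
  suff /choice[l lP] : forall j, exists l : R, forall eps : R, 0 < eps ->
      F [set x : ell2 R n | `|l - p (x 0 j)| < eps] by exists l.
  move=> j; pose q (x : ell2 R n) : R := p (x 0 j).
  have cq : cvg (q @ F).
    apply: cauchy_cvg; apply/cauchyP => eps eps0.
    have [|x Fx] := cF eps%:C%C; first by rewrite ltcR.
    exists (q x); change (F (q @^-1` ball (q x) eps)); apply: filterS Fx => y.
    rewrite -!ball_normE /ball_/= => xy; rewrite -ltcR; apply: le_lt_trans xy.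
    rewrite /q -pB; apply: le_trans (pN _) _.
    by rewrite (_ : x 0 j - y 0 j = (x - y) 0 j) ?ell2_coord_le// !mxE.
  exists (lim (q @ F)) => eps eps0.
  by have /cvgrPdist_lt/(_ _ eps0) := cq.
have [a aP] := lim1 _ (raddfB (@complex.Re R : Rcomplex R -> R)) (@normc_ge_Re _).
have [b bP] := lim1 _ (raddfB (@complex.Im R : Rcomplex R -> R)) (@normC_ge_Im).
apply/cvg_ex; exists (\row_j (a j +i* b j)%C : ell2 R n).
apply/cvgrPdist_lt => eps eps0.
have epsE : eps = (complex.Re eps)%:C%C by rewrite RRe_real// gtr0_real.
have e0 : 0 < complex.Re eps by rewrite -ltcR -epsE.
(* Each of the n coordinates contributes at most 2r, in total n/(n+1) eps < eps; the successor also
   covers n = 0. *)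
pose r := complex.Re eps / (2 * n.+1%:R).
have r0 : 0 < r by rewrite divr_gt0// mulr_gt0// ltr0n.
have FP : \forall x \near F, forall j : 'I_n,
    `|a j - complex.Re ((x : ell2 R n) 0 j)| < r /\ `|b j - complex.Im (x 0 j)| < r.
  by apply: filter_forall => j; exact: filterI (aP _ _ r0) (bP _ _ r0).
apply: filterS FP => x xP; rewrite (le_lt_trans (ell2_norm_le _))// epsE.
apply: (@le_lt_trans _ _ (\sum_(j < n) (r + r)%:C%C)).
  apply: ler_sum => j _; rewrite (le_trans (normC_le_Re_Im _))// lecR.
  have [/ltW Hr /ltW Hi] := xP j.
  rewrite !mxE; apply: lerD; [apply: le_trans Hr | apply: le_trans Hi];
  by rewrite raddfB.
rewrite sumr_const card_ord -rmorphMn ltcR -mulr_natr /r.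
rewrite (_ : _ + _ = complex.Re eps / n.+1%:R); last first.
  by field; rewrite ?natr1 ?nat1r pnatr_eq0.
by rewrite mulrAC ltr_pdivrMr ?ltr0n// ltr_pM2l// ltr_nat.
Qed.

HB.instance Definition _ := Uniform_isComplete.Build (ell2 R n) ell2_complete.

Definition ell2_hilbert : hilbertType R := @Hilbert R (ell2 R n) ell2_dot ell2_norm_sqr.

End Ell2.

(** * The standard matrix units on l^2_n *)

Section Ell2Units.
Context {R : realType} {n : nat}.
Local Notation C := R[i].
Local Notation H := (@ell2_hilbert R n).

(** Vectors are rows, acted on from the right; hence the transposed indices. *)
Definition ell2_elem (i j : 'I_n) : H -> H := fun x : 'rV[C]_n => x *m delta_mx j i.

Lemma ell2_elemE i j (x : ell2 R n) a :
  (ell2_elem i j x : ell2 R n) 0 a = x 0 j * (a == i)%:R.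
Proof.
rewrite mxE (bigD1 j)//= big1 ?addr0 => [|k kj]; last by rewrite mxE (negbTE kj) mulr0.
by rewrite mxE eqxx.
Qed.

Lemma ell2_elem_bounded i j : bounded_operator (ell2_elem i j).
Proof.
split; first by move=> a x y; rewrite /ell2_elem mulmxDl -scalemxAl.
exists 1 => x; rewrite mul1r; apply: le_trans (ell2_norm_le _) _.
rewrite (bigD1 i)//= big1 ?addr0 => [|a ai].
  by rewrite ell2_elemE eqxx mulr1; exact: ell2_coord_le.
by rewrite ell2_elemE (negbTE ai) mulr0 normr0.
Qed.

Lemma adjoint_ell2_elem i j : adjoint (ell2_elem i j) = ell2_elem j i.
Proof.
apply: adjointP => x y; rewrite /= !ell2_dotE.
rewrite [LHS](bigD1 i)//= [X in _ + X]big1 => [|k ki]; last first.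
  by rewrite ell2_elemE (negbTE ki) mulr0 mul0r.
rewrite [RHS](bigD1 j)//= [X in _ = _ + X]big1 => [|k kj]; last first.
  by rewrite ell2_elemE (negbTE kj) mulr0 rmorph0 mulr0.
by rewrite !ell2_elemE !eqxx !mulr1.
Qed.

Definition ell2_unit i j : @adjop_starAlg R H :=
  AdjOp (adjointable_bounded (ell2_elem_bounded i j)).

Lemma ell2_unit_units : matrix_units ell2_unit.
Proof.
move=> i j k l p q; apply: val_inj; rewrite /= adjoint_ell2_elem.
apply/funext => x /=; rewrite /ell2_elem -!mulmxA.
rewrite mul_delta_mx_cond [l == j]eq_sym; case: (eqVneq j l) => _ /=; last first.
  by rewrite mulr0n !mulmx0.
rewrite mulr1n mul_delta_mx_cond [p == k]eq_sym; case: eqP => _ //=.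
by rewrite mulr0n mulmx0.
Qed.

Lemma ell2_unit_neq0 i j : ell2_unit i j != 0.
Proof.
apply/eqP => /(congr1 adjop_fun) e0.
have := congr1 (fun g : H -> H => (g (delta_mx 0 j : 'rV[C]_n) : ell2 R n) 0 i) e0.
rewrite ell2_elemE mxE !eqxx mulr1 [RHS](_ : _ = 0) => [/eqP|].
  by rewrite oner_eq0.
exact: mxE.
Qed.

End Ell2Units.

(** * Homomorphisms out of the triple system *)

Definition cstar_starAlg (R : realType) (A : cstarAlgType R) : starAlgType R[i] :=
  @StarAlg R[i] A _ _ (@cmulA R A) (@cmul_linearl R A) (@cmul_linearr R A)
    (@cstarK R A) (@cstar_antilinear R A) (@cstarM R A).

(** Of the eight terms of the expansion only e_kl e_il^* e_ij survives. So the skew combinations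
    generate all the units. *)
Lemma units_sternary (K : numClosedFieldType) (V : starAlgType K) (I : eqType)
    (e : I -> I -> V) k l i j : matrix_units e -> uniq [:: k; l; i] -> i != j ->
  sternary (e k l - e l k) (e i l - e l i) (e i j - e j i) = e k j.
Proof.
move=> eU u ij; have [kl ki li] : [/\ k != l, k != i & l != i].
  by split; distinct.
have tB x y z x' y' z' : sternary (x - x' : V) (y - y') (z - z') =
    (sternary x y z - sternary x y z' - (sternary x y' z - sternary x y' z'))
    - (sternary x' y z - sternary x' y z' - (sternary x' y' z - sternary x' y' z')).
  have Bl (a b c : V) : (a - b) ** c = a ** c - b ** c by rewrite smulDl smulNl.
  have Br (a b c : V) : c ** (a - b) = c ** a - c ** b by rewrite smulDr smulNr.
  by rewrite /sternary sstarD sstarN !Bl !(Br (y^') (y'^')) !Bl !Br.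
rewrite tB !eU !eqxx /=.
rewrite ?[l == i](negbTE li) ?[i == l]eq_sym ?(negbTE li) ?(negbTE ij) ?(negbTE kl).
by rewrite ?(negbTE ki) /= ?andbF !subr0.
Qed.

(** * Maps that are linear on a subspace only *)

Section SubspaceMaps.
Context {K : numClosedFieldType} {V W : lmodType K} (Z : set V) (f : V -> W).
Context (subZ : is_subspace Z) (linf : linear_on Z f).

Lemma linear_on0 : f 0 = 0.
Proof.
have := linf 1 subZ.1 subZ.1.
by rewrite scaler0 addr0 scale1r => /(congr1 (fun x => x - f 0)); rewrite subrr addrK.
Qed.

Lemma linear_onZ a x : Z x -> f (a *: x) = a *: f x.
Proof. by move=> Zx; have := linf a Zx subZ.1; rewrite !addr0 linear_on0 addr0. Qed.

Lemma linear_onD x y : Z x -> Z y -> f (x + y) = f x + f y.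
Proof. by move=> Zx Zy; have := linf 1 Zx Zy; rewrite !scale1r. Qed.

Lemma subspaceZ a x : Z x -> Z (a *: x).
Proof. by move=> Zx; rewrite -[_ *: _]addr0; apply: subZ.2 => //; exact: subZ.1. Qed.

Lemma subspaceD x y : Z x -> Z y -> Z (x + y).
Proof. by move=> Zx Zy; rewrite -[x]scale1r; exact: subZ.2. Qed.

Lemma linear_on_sum (I : finType) (P : pred I) (F : I -> V) :
  (forall i, P i -> Z (F i)) ->
  Z (\sum_(i | P i) F i) /\ f (\sum_(i | P i) F i) = \sum_(i | P i) f (F i).
Proof.
move=> FZ; apply: (big_ind2 (fun x y => Z x /\ f x = y)).
- by split; [exact: subZ.1 | exact: linear_on0].
- by move=> x _ y _ [Zx <-] [Zy <-]; split; [exact: subspaceD | rewrite linear_onD].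
- by move=> i Pi; split => //; exact: FZ.
Qed.

End SubspaceMaps.

(** * Images of the grid under triple homomorphisms *)

Section GridImages.
Context {R : realType} {A : cstarAlgType R} {Z : set A} {n : nat}.
Local Notation C := R[i].
Context (u : 'I_n -> 'I_n -> A) (subZ : is_subspace Z) (gu : symplectic_grid Z u).

Lemma grid_in i j : i != j -> Z (u i j).
Proof. by move=> ij; case: (syg_minimal gu ij). Qed.

(** As u_ji = -u_ij, coefficients over ordered pairs are redundant; skew-symmetrising them gives the
    coordinates over the matrix units. *)
Definition skew_mx (c : 'I_n -> 'I_n -> C) : 'M[C]_n :=
  \matrix_(i, j) (if i == j then 0 else c i j - c j i).

Section Image.
Context {V : starAlgType C} (f : A -> V) (linf : linear_on Z f).
Context (fT : forall x y z, Z x -> Z y -> Z z ->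
  f (cstar_triple x y z) =
  2^-1 *: (sternary (f x) (f y) (f z) + sternary (f z) (f y) (f x))).

Lemma grid_image_laws : symplectic_laws (fun i j => f (u i j)).
Proof.
have fN x : Z x -> f (- x) = - f x.
  by move=> Zx; have := linear_onZ subZ linf (-1) Zx; rewrite !scaleN1r.
have half x y : 2^-1 *: x = 2^-1 *: y :> V -> x = y.
  by apply: scalerI; rewrite invr_eq0 pnatr_eq0.
have dbl x : 2^-1 *: (x + x) = x :> V.
  by rewrite scalerDr -scalerDl -mulr2n -[_ *+ 2]mulr_natr mulVf ?scale1r ?pnatr_eq0.
have Zu := grid_in.
split.
- by move=> i j ij; rewrite (syg1 gu) 1?eq_sym// fN//; exact: Zu.
- move=> i j ij; have [_ /(congr1 f) + _] := syg_minimal gu ij.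
  rewrite fT; do ?exact: Zu.
  by rewrite dbl.
- move=> i j k ijk; have [ij ik jk] : [/\ i != j, i != k & j != k] by split; distinct.
  have [|| + _] := @syg2 _ _ _ _ _ gu i j i k ij ik.
  + by apply/set0Pn; exists i; rewrite !inE eqxx.
  + apply: contra jk => /eqP/setP/(_ j); rewrite !inE eqxx orbT => /esym.
    by rewrite eq_sym (negbTE ij).
  move=> /(congr1 f); rewrite fT; do ?exact: Zu.
  by rewrite (linear_onZ subZ linf) => [/half|]; last exact: Zu.
- move=> i j k l ijkl; have [ij kl] : i != j /\ k != l by split; distinct.
  have := @syg3 _ _ _ _ _ gu k l i j kl ij.
  have -> : ([set k; l] :&: [set i; j] = finset.set0)%SET.
    apply/setP => x; rewrite !inE; apply/negP => /andP[/orP[]/eqP-> /orP[]/eqP E];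
    by move: ijkl; rewrite E /= !inE eqxx ?orbT ?andbF.
  move=> /(_ erefl)/(congr1 f); rewrite fT; do ?exact: Zu.
  by rewrite (linear_on0 subZ linf) -[RHS](scaler0 _ (2^-1 : C)) => /half.
- move=> i j k l ijkl.
  have [ij il kl kj] : [/\ i != j, i != l, k != l & k != j] by split; distinct.
  have /(congr1 f) := @syg4 _ _ _ _ _ gu i j k l ijkl.
  rewrite fT; do ?exact: Zu.
  by rewrite (linear_onZ subZ linf) => [/half|]; last exact: Zu.
Qed.

Lemma grid_image_span (e : 'I_n -> 'I_n -> V) :
  (forall i j, i != j -> f (u i j) = e i j - e j i) -> forall c,
  f (\sum_i \sum_(j | j != i) c i j *: u i j) = mx_comb e (skew_mx c).
Proof.
move=> fu c; rewrite (linear_on_sum subZ linf _).2; last first.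
  move=> i _; apply: (linear_on_sum subZ linf _).1 => j ji.
  by apply: subspaceZ => //; apply: grid_in; rewrite eq_sym.
rewrite (_ : \sum_i _ = \sum_i \sum_j (if i == j then 0 else c i j *: (e i j - e j i))).
  have E : mx_comb e (skew_mx c) = \sum_i \sum_j
    ((if i == j then 0 else c i j *: e i j) - (if i == j then 0 else c j i *: e i j)).
    apply: eq_bigr => i _; apply: eq_bigr => j _; rewrite mxE.
    by case: eqP => _; rewrite ?scale0r ?subrr// scalerBl.
  rewrite {}E; under [RHS]eq_bigr do rewrite sumrB.
  rewrite sumrB [X in _ - X]exchange_big -sumrB; apply: eq_bigr => i _.
  rewrite -sumrB; apply: eq_bigr => j _; rewrite [j == i]eq_sym.
  by case: eqP => _; rewrite ?subrr// scalerBr.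
apply: eq_bigr => i _; rewrite (linear_on_sum subZ linf _).2; last first.
  by move=> j ji; apply: subspaceZ => //; apply: grid_in; rewrite eq_sym.
rewrite big_mkcond; apply: eq_bigr => j _; rewrite eq_sym; case: eqVneq => //= ij.
by rewrite (linear_onZ subZ linf) ?fu//; exact: grid_in.
Qed.

End Image.
End GridImages.

Lemma unit_span_sub (R : realType) (H : hilbertType R) (n : nat)
    (e : 'I_n -> 'I_n -> @adjop_starAlg R H) (T : set (H -> H)) :
  is_subspace T -> (forall i j, T (adjop_fun (e i j))) -> unit_span e `<=` T.
Proof.
move=> subT eT _ [M _ <-]; pose P (g : @adjop_starAlg R H) := T (adjop_fun g).
have P0 : P 0 by exact: subT.1.
have PD g h : P g -> P h -> P (g + h) by exact: (subspaceD subT).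
have PZ a g : P g -> P (a *: g) by exact: (subspaceZ subT).
rewrite -/(P _) /mx_comb.
by apply: (big_ind P) => // i _; apply: (big_ind P) => // j _; exact/PZ/eT.
Qed.

(** * The universal TRO of the span of the grid *)

Section UniversalTROofGrid.
Context {R : realType} {A : cstarAlgType R} {Z : set A} {n : nat}.
Local Notation C := R[i].
Context (u : 'I_n -> 'I_n -> A) (subZ : is_subspace Z) (gu : symplectic_grid Z u).
Context (Zt : forall x y z, Z x -> Z y -> Z z -> Z (cstar_triple x y z)).
Context (uZ : Z = grid_span u) (n5 : (4 < n)%N).

Let card5 : (4 < #|'I_n|)%N. Proof. by rewrite card_ord. Qed.

(** The identity of [A] is itself a triple homomorphism on [Z]. A non-zero unit exists because u_ij
    = e_ij - e_ji is non-zero. *)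
Lemma grid_units : exists e : 'I_n -> 'I_n -> cstar_starAlg A,
  [/\ matrix_units e, forall i j, i != j -> u i j = e i j - e j i,
      forall c, \sum_i \sum_(j | j != i) c i j *: u i j = mx_comb e (skew_mx c) &
      exists i j, e i j != 0].
Proof.
have lin_id : linear_on Z (id : A -> cstar_starAlg A) by [].
have laws := grid_image_laws subZ gu lin_id (fun x y z _ _ _ => erefl).
pose e := symp_unit (fun i j => u i j : cstar_starAlg A).
have uE i j : i != j -> u i j = e i j - e j i by exact: (symp_unitB card5 laws).
exists e; split=> //.
- exact: (symp_unit_units card5 laws).
- by move=> c; rewrite -(grid_image_span subZ gu lin_id uE).
have [i0 [j0 ij]] : exists i j : 'I_n, i != j.
  exists (Ordinal (ltn_trans (isT : (0 < 4)%N) n5)).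
  by exists (Ordinal (ltn_trans (isT : (1 < 4)%N) n5)).
have := syg_neq0 gu ij; rewrite uE//; have [->|] := eqVneq (e i0 j0) 0.
  by rewrite sub0r oppr_eq0; exists j0, i0.
by exists i0, j0.
Qed.

Lemma JB_hom_units (H : hilbertType R) (T : set (H -> H)) (rho : A -> H -> H) :
  is_TRO T -> JB_hom Z T rho ->
  exists e : 'I_n -> 'I_n -> @adjop_starAlg R H,
  [/\ matrix_units e, forall i j, T (adjop_fun (e i j)),
      forall k l i j, uniq [:: k; l; i] -> i != j ->
        adjop_fun (e k j) = op_ternary (rho (u k l)) (rho (u i l)) (rho (u i j)) &
      forall c, rho (\sum_i \sum_(j | j != i) c i j *: u i j) =
        adjop_fun (mx_comb e (skew_mx c))].
Proof.
move=> [Tb subT _ Tt] [rhoT rho_lin rho_hom].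
(* The default 0 is never taken on [Z], where [rho] has bounded, hence adjointable, values. *)
pose f (z : A) : @adjop_starAlg R H := insubd (0 : @adjop R H) (rho z).
have fE z : Z z -> adjop_fun (f z) = rho z.
  by move=> Zz; exact: insubdK (adjointable_bounded (Tb _ (rhoT _ Zz))).
have f_lin : linear_on Z f.
  move=> a x y Zx Zy; apply: val_inj; rewrite /= !fE//; last exact: subZ.2.
  by rewrite rho_lin.
have fT x y z : Z x -> Z y -> Z z -> f (cstar_triple x y z) =
    2^-1 *: (sternary (f x) (f y) (f z) + sternary (f z) (f y) (f x)).
  move=> Zx Zy Zz; apply: val_inj; rewrite /= fE; last exact: Zt.
  by rewrite rho_hom// /op_triple /jordan_triple !fE.
have laws := grid_image_laws subZ gu f_lin fT.
have Zu := grid_in gu.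
pose e := symp_unit (fun i j => f (u i j)).
have eE k l i j : uniq [:: k; l; i] -> i != j ->
    adjop_fun (e k j) = op_ternary (rho (u k l)) (rho (u i l)) (rho (u i j)).
  move=> kli ij; rewrite /e (symp_unit_sternary card5 laws kli ij) adjop_sternary.
  by rewrite !fE//; apply: Zu => //; distinct.
exists e; split=> //.
- exact: (symp_unit_units card5 laws).
- move=> k j; have [l lP] := @fresh_index _ card5 [:: k] isT.
  have [i iP] := @fresh_index _ card5 [:: k; l; j] isT.
  rewrite (@eE k l i j); try by distinct.
  by apply: Tt; apply: rhoT; apply: Zu; distinct.
- move=> c; rewrite -(grid_image_span subZ gu f_lin) ?fE// => [|i j ij].
    by rewrite uZ; exists c.
  exact: (symp_unitB card5 laws).
Qed.

(* rho_Z expands z over the matrix units generated by the grid in A itself and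
   transports the coefficients to the matrix units of B(l^2_n). *)
Lemma universal_TRO_exists : exists (rho : A -> @ell2_hilbert R n -> @ell2_hilbert R n),
  is_universal_TRO Z (unit_span (@ell2_unit R n)) rho /\
  forall i j, i != j ->
    rho (u i j) = adjop_fun (ell2_unit i j - ell2_unit j i : @adjop_starAlg R _).
Proof.
have [a [aU uE aZ [i0 [j0 a0]]]] := grid_units.
set T0 := unit_span _; set E := @ell2_unit R n.
have EU : matrix_units E by exact: ell2_unit_units.
have E0 : E i0 j0 != 0 by exact: ell2_unit_neq0.
(* Coordinates over the units in [A], unique by [mx_comb_inj]; the default 0 concerns only elements
   outside their span. *)
pose coef (z : A) : 'M[C]_n := xget 0 [set M | mx_comb a M = z].
have coefK M : coef (mx_comb a M) = M.
  rewrite /coef; case: xgetP => [N _|/(_ M)/(_ erefl)//].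
  exact: (mx_comb_inj aU a0).
pose opcoef (g : @ell2_hilbert R n -> _) : 'M[C]_n :=
  xget 0 [set M | adjop_fun (mx_comb E M) = g].
have opcoefK M : opcoef (adjop_fun (mx_comb E M)) = M.
  rewrite /opcoef; case: xgetP => [N _|/(_ M)/(_ erefl)//].
  by move=> /val_inj; exact: (mx_comb_inj EU E0).
have Za z : Z z -> exists M, z = mx_comb a M.
  by rewrite uZ => -[c ->]; exists (skew_mx c); rewrite -aZ.
have T0_TRO : is_TRO T0.
  by apply: unit_span_TRO E0; [exact: EU | exact: ell2_elem_bounded].
have tA (x y z : cstar_starAlg A) : cstar_ternary x y z = sternary x y z by [].
pose rho (z : A) := adjop_fun (mx_comb E (coef z)).
have rho_u i j : i != j -> rho (u i j) = adjop_fun (E i j - E j i).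
  move=> ij; rewrite /rho uE// -!(mx_comb_delta a) -raddfB coefK raddfB /=.
  by rewrite !mx_comb_delta.
have rhoJB : JB_hom Z T0 rho.
  split=> [z _|b x y /Za[L ->] /Za[M ->]|x y z /Za[L ->] /Za[M ->] /Za[N ->]].
  - by exists (coef z).
  - have -> : b *: mx_comb a L + mx_comb a M = mx_comb a (b *: L + M).
      by rewrite linearP.
    by rewrite /rho !coefK linearP.
  - rewrite /rho /cstar_triple /op_triple /jordan_triple !tA !(mx_comb_sternary aU).
    set P := _ *m N; set Q := _ *m L.
    have -> : 2^-1 *: (mx_comb a P + mx_comb a Q) = mx_comb a (2^-1 *: (P + Q)).
      by rewrite [RHS]linearZ [in RHS]linearD.
    have EP (X Y W : 'M[C]_n) :
        op_ternary (adjop_fun (mx_comb E X)) (adjop_fun (mx_comb E Y))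
          (adjop_fun (mx_comb E W)) =
        adjop_fun (mx_comb E (X *m map_mx Num.conj Y^T *m W)).
      by rewrite -(mx_comb_sternary EU).
    by rewrite !coefK !EP linearZ linearD.
exists rho; split=> //; split=> //.
(* [T0] is a TRO containing the image of [Z]; conversely, any such TRO contains every E_kj, a
   ternary product of three grid images. *)
- apply/seteqP; split=> [g /(_ T0)|g].
    by apply; split=> // _ [z _ <-]; exists (coef z).
  move=> [M _ <-] T [T_TRO rhoT]; have [_ subT _ Tt] := T_TRO.
  have ET k j : T (adjop_fun (E k j)).
    have [l lP] := @fresh_index _ card5 [:: k] isT.
    have [i iP] := @fresh_index _ card5 [:: k; l; j] isT.
    rewrite -(@units_sternary _ _ _ E k l i j EU); try by distinct.
    rewrite adjop_sternary -!rho_u; try by distinct.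
    by apply: Tt; apply: rhoT; (eexists; last reflexivity);
       apply: (grid_in gu); distinct.
  by apply: (unit_span_sub subT ET); exists M.
- move=> H' T' alpha T'_TRO alphaJB.
  have [e [eU eT _ eZ]] := JB_hom_units T'_TRO alphaJB.
  have [_ subT' _ _] := T'_TRO.
  have span_eT M : T' (adjop_fun (mx_comb e M)).
    by apply: (unit_span_sub subT' eT); exists M.
  (* The factorization keeps the coordinates and replaces the units E of l^2_n by those generated by
     [alpha]. *)
  exists (fun g => adjop_fun (mx_comb e (opcoef g))).
    split=> [g _|b _ _ [L _ <-] [M _ <-]|_ _ _ [L _ <-] [M _ <-] [N _ <-]].
    + exact: span_eT.
    + have -> : b *: adjop_fun (mx_comb E L) + adjop_fun (mx_comb E M) =
          adjop_fun (mx_comb E (b *: L + M)) by rewrite linearP.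
      by rewrite !opcoefK linearP.
    + rewrite -!adjop_sternary (mx_comb_sternary EU) !opcoefK.
      by rewrite (mx_comb_sternary eU).
  by move=> z; rewrite uZ => -[c ->]; rewrite eZ /rho aZ coefK opcoefK.
Qed.

(** The units generated by [rho] span a TRO that contains the image of [Z], hence all of [T];
    reading off coordinates is the isomorphism. *)
Lemma universal_TRO_mx (H : hilbertType R) (T : set (H -> H)) (rho : A -> H -> H) :
  is_universal_TRO Z T rho -> TRO_isomorphic_mx T n.
Proof.
move=> [T_TRO rhoJB Tgen Tuniv]; have [Tb subT _ _] := T_TRO.
have [e [eU eT eE eZ]] := JB_hom_units T_TRO rhoJB.
have [rho0 [[T0_TRO rho0JB _ _] rho0u]] := universal_TRO_exists.
have [phi phiT phi_rho] := Tuniv _ _ _ T0_TRO rho0JB.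
have [rhoT _ _] := rhoJB.
have Zu := grid_in gu.
pose i0 : 'I_n := Ordinal (ltn_trans (isT : (0 < 4)%N) n5).
(* The universal property maps [T] to the concrete model on l^2_n, carrying this unit to the
   non-zero E_00. *)
have e0 : e i0 i0 != 0.
  apply/eqP => e00.
  have [l lP] := @fresh_index _ card5 [:: i0] isT.
  have [i iP] := @fresh_index _ card5 [:: i0; l] isT.
  have u3 : uniq [:: i0; l; i] by distinct.
  have ii0 : i != i0 by distinct.
  have := congr1 phi (eE _ _ _ _ u3 ii0).
  have [_ phi_lin phi_hom] := phiT.
  rewrite e00 (linear_on0 subT phi_lin).
  rewrite phi_hom; do ?by apply: rhoT; apply: Zu; distinct.
  rewrite -!phi_rho; do ?by apply: Zu; distinct.
  rewrite !rho0u; do ?by distinct.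
  rewrite -adjop_sternary units_sternary//; last exact: ell2_unit_units.
  by move/esym => h; have /eqP := @ell2_unit_neq0 R n i0 i0; apply; exact: val_inj.
have TE : T = unit_span e.
  apply/seteqP; split; last exact: unit_span_sub.
  rewrite -Tgen => g; apply; split.
    by apply: unit_span_TRO e0 => // i j; exact: Tb.
  by move=> _ [z + <-]; rewrite uZ => -[c ->]; rewrite eZ; eexists.
pose coef (g : H -> H) : 'M[C]_n := xget 0 [set M | adjop_fun (mx_comb e M) = g].
have coefK M : coef (adjop_fun (mx_comb e M)) = M.
  rewrite /coef; case: xgetP => [N _|/(_ M)/(_ erefl)//].
  by move=> /val_inj; exact: (mx_comb_inj eU e0).
exists coef; rewrite TE; split; split=> //.
- move=> b _ _ [L _ <-] [M _ <-].
  have -> : b *: adjop_fun (mx_comb e L) + adjop_fun (mx_comb e M) =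
      adjop_fun (mx_comb e (b *: L + M)) by rewrite linearP.
  by rewrite !coefK.
- move=> _ _ _ [L _ <-] [M _ <-] [N _ <-].
  by rewrite -!adjop_sternary (mx_comb_sternary eU) !coefK.
- by move=> _ _ /set_mem[L _ <-] /set_mem[M _ <-]; rewrite !coefK => ->.
- by move=> M _; exists (adjop_fun (mx_comb e M)) => //; exists M.
Qed.

End UniversalTROofGrid.

(** * From the dimension bound to n >= 5 *)

Lemma card_ltn_pairs (n : nat) :
  #|[set p : 'I_n * 'I_n | (p.1 < p.2)%N]%SET| = 'C(n, 2)%N.
Proof.
rewrite -bin2_sum big_mkord -sum1_card.
have -> : (\sum_(p in [set p : 'I_n * 'I_n | (p.1 < p.2)%N]%SET) 1 =
    \sum_(i < n) \sum_(j < n | (i < j)%N) 1)%N.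
  by rewrite pair_big_dep; apply: eq_bigl => p; rewrite inE.
rewrite (exchange_big_dep xpredT)//=; apply: eq_bigr => j _.
by rewrite -(big_ord_widen n (fun=> 1%N) (ltnW (ltn_ord j))) sum1_card card_ord.
Qed.

(** The u_ij with i < j already span. More vectors than such pairs have a coefficient matrix with
    non-zero left kernel, whose elements are linear dependences. *)
Lemma skew_span_dim (R : realType) (A : cstarAlgType R) (n : nat)
    (u : 'I_n -> 'I_n -> A) (d : nat) :
  (forall i j, i != j -> u i j = - u j i) -> dim_ge (grid_span u) d ->
  (d <= 'C(n, 2))%N.
Proof.
move=> uN [v vZ vfree]; rewrite -card_ltn_pairs; set P := [set p | _]%SET.
have /choice[c cE] : forall m, exists c : 'I_n -> 'I_n -> R[i],
    v m = \sum_(p in P) c p.1 p.2 *: u p.1 p.2.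
  move=> m; have [c ->] := vZ m; exists (fun i j => c i j - c j i).
  have -> : \sum_(p in P) (c p.1 p.2 - c p.2 p.1) *: u p.1 p.2 =
      \sum_(i < n) \sum_(j < n | (i < j)%N) (c i j - c j i) *: u i j.
    by rewrite pair_big_dep; apply: eq_bigl => p; rewrite inE.
  rewrite (eq_bigr (fun i : 'I_n => \sum_(j < n | (i < j)%N) c i j *: u i j +
                              \sum_(j < n | (j < i)%N) c i j *: u i j)); last first.
    move=> i _; rewrite (bigID (fun j : 'I_n => (i < j)%N)) /=.
    congr (_ + _); apply: eq_bigl => j.
      by rewrite andbC -val_eqE /=; case: ltngtP.
    by rewrite -leqNgt andbC -val_eqE /= ltn_neqAle andbC.
  rewrite big_split /= [X in _ + X](exchange_big_dep xpredT)//= -big_split.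
  apply: eq_bigr => i _; rewrite -big_split; apply: eq_bigr => j ij /=.
  rewrite scalerBl (uN j i) ?scalerN//.
  by apply: contraTN ij => /eqP->; rewrite ltnn.
rewrite leqNgt; apply/negP => Pd.
pose D : 'M[R[i]]_(d, #|P|) := \matrix_(m, k) c m (enum_val k).1 (enum_val k).2.
have /rowV0Pn[w wK w0] : kermx D != 0.
  rewrite -mxrank_eq0 mxrank_ker subn_eq0 -ltnNge.
  exact: leq_ltn_trans (rank_leq_col D) Pd.
have wD : w *m D = 0 by apply/sub_kermxP.
have /vfree wz : \sum_m w 0 m *: v m = 0.
  under eq_bigr => m _ do rewrite cE scaler_sumr.
  rewrite exchange_big big_enum_val big1// => k _ /=.
  under eq_bigr do rewrite scalerA.
  rewrite -scaler_suml; have /rowP/(_ k) := wD; rewrite !mxE => w0k.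
  rewrite (_ : \sum_m _ = 0) ?scale0r//; apply: etrans w0k.
  by apply: eq_bigr => m _; rewrite mxE.
by move/negP: w0; apply; apply/eqP/rowP => m; rewrite mxE wz.
Qed.

Theorem theorem3p6 (R : realType) (A : cstarAlgType R) (Z : set A) (n : nat)
    (u : 'I_n -> 'I_n -> A) :
  is_JCstar_triple Z ->
  symplectic_grid Z u ->
  Z = grid_span u ->
  dim_ge Z 10 ->
  (exists (H : hilbertType R) (T : set (H -> H)) (rho : A -> H -> H),
     is_universal_TRO Z T rho) /\
  (forall (H : hilbertType R) (T : set (H -> H)) (rho : A -> H -> H),
     is_universal_TRO Z T rho -> TRO_isomorphic_mx T n).
Proof.
move=> [subZ _ Zt] gu uZ dimZ.
have n5 : (4 < n)%N.
  (* For n <= 4 the dimension is at most C(4,2) = 6 < 10. *)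
  rewrite ltnNge; apply/negP => n4.
  have := skew_span_dim (syg1 gu); rewrite -uZ => /(_ 10 dimZ).
  by move=> /leq_trans/(_ (leq_bin2l 2 n4)).
split=> [|H T rho]; last exact: (universal_TRO_mx subZ gu Zt uZ n5).
have [rho [rhoU _]] := universal_TRO_exists subZ gu Zt uZ n5.
by exists (@ell2_hilbert R n), (unit_span (@ell2_unit R n)), rho.
Qed.
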